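(* Let $G \leq \mathrm{Homeo}(\mathfrak{C})$ be a finitely generated simple vigorous group. Let $m \geq 2$ and $n \geq 3$ be integers. Then $G$ is $(m,n)$-generated, that is, there exist $\alpha, \beta \in G$ with $\alpha$ of order $m$, $\beta$ of order $n$ and $G = \langle \alpha, \beta \rangle$.
   Context: $\mathfrak{C}$ denotes Cantor space and $\mathrm{Homeo}(\mathfrak{C})$ its group of homeomorphisms, acting on the right. A group $G \leq \mathrm{Homeo}(\mathfrak{C})$ is vigorous if for every clopen subset $A$ of $\mathfrak{C}$ and all proper nonempty clopen subsets $B$ and $C$ of $A$ there exists $\gamma \in G$ such that $B\gamma \subseteq C$ and $\gamma$ fixes $\mathfrak{C} \setminus A$ pointwise. *)

(* Defs.v *)
From HB Require Import structures.
From mathcomp Require Import all_boot.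
From mathcomp Require Import boolp classical_sets cardinality topology cantor.

Set Implicit Arguments.
Unset Strict Implicit.
Unset Printing Implicit Defensive.

Local Open Scope classical_set_scope.

(* The inverse is stored as data; it is determined by the underlying map, so
   equality of homeomorphisms is equality of the underlying maps (homeoP). *)
Record homeo (T : topologicalType) := Homeo {
  homeo_fun :> T -> T;
  homeo_inv : T -> T;
  homeo_funK : cancel homeo_fun homeo_inv;
  homeo_invK : cancel homeo_inv homeo_fun;
  homeo_continuous : continuous homeo_fun;
  homeo_inv_continuous : continuous homeo_inv
}.

HB.instance Definition _ (T : topologicalType) := gen_eqMixin (homeo T).
HB.instance Definition _ (T : topologicalType) := gen_choiceMixin (homeo T).

Section HomeoGroup.
Variable T : topologicalType.
Implicit Types f g h : homeo T.

Lemma homeoP f g : homeo_fun f =1 homeo_fun g -> f = g.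
Proof.
case: f g => [f f' fK f'K cf cf'] [g g' gK g'K cg cg'] /= /funext fg.
move: fK f'K cf cf'; rewrite fg => fK f'K cf cf'.
have fg' : f' = g' by apply/funext => x; rewrite -{1}(g'K x) fK.
move: fK f'K cf cf'; rewrite fg' => fK f'K cf cf'.
by congr Homeo; exact: Prop_irrelevance.
Qed.

Lemma id_homeo_continuous : continuous (id : T -> T).
Proof. by move=> x; exact: cvg_id. Qed.

Definition homeo_one : homeo T :=
  Homeo (fun=> erefl) (fun=> erefl) id_homeo_continuous id_homeo_continuous.

(* Homeomorphisms act on the right: the product f * g is "f, then g". *)
Definition homeo_mul f g : homeo T :=
  @Homeo T (g \o f) (homeo_inv f \o homeo_inv g)
    (can_comp (@homeo_funK T g) (@homeo_funK T f))
    (can_comp (@homeo_invK T f) (@homeo_invK T g))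
    (fun x => continuous_comp (@homeo_continuous T f x)
                              (@homeo_continuous T g (f x)))
    (fun x => continuous_comp (@homeo_inv_continuous T g x)
                              (@homeo_inv_continuous T f (homeo_inv g x))).

Definition homeo_opp f : homeo T :=
  Homeo (@homeo_invK T f) (@homeo_funK T f)
        (@homeo_inv_continuous T f) (@homeo_continuous T f).

Lemma homeo_mulA : associative homeo_mul.
Proof. by move=> f g h; exact: homeoP. Qed.

Lemma homeo_mul1 : left_id homeo_one homeo_mul.
Proof. by move=> f; exact: homeoP. Qed.

Lemma homeo_mulr1 : right_id homeo_one homeo_mul.
Proof. by move=> f; exact: homeoP. Qed.

Lemma homeo_mulV : left_inverse homeo_one homeo_opp homeo_mul.
Proof. by move=> f; apply: homeoP => x /=; exact: homeo_invK. Qed.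

Lemma homeo_mulrV : right_inverse homeo_one homeo_opp homeo_mul.
Proof. by move=> f; apply: homeoP => x /=; exact: homeo_funK. Qed.

HB.instance Definition _ := isGroup.Build (homeo T)
  homeo_mulA homeo_mul1 homeo_mulr1 homeo_mulV homeo_mulrV.

End HomeoGroup.

Section Subgroups.
Local Open Scope group_scope.
Variable gT : groupType.
Implicit Types (A G N : set gT) (x : gT).

Definition is_subgroup G : Prop := group_closed (mem G).

Lemma is_subgroupP G :
  is_subgroup G <->
  [/\ G 1, forall x y, G x -> G y -> G (x * y) & forall x, G x -> G x^-1].
Proof.
split=> [[G1 GB]|[G1 GM GV]].
  have {}G1 : G 1 by rewrite -in_setE.
  have {}GB x y : G x -> G y -> G (x / y).
    by move=> Gx Gy; rewrite -in_setE; apply: GB; rewrite inE.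
  have GV x : G x -> G x^-1 by move=> Gx; rewrite -[x^-1]mul1g; exact: GB.
  by split=> // x y Gx Gy; rewrite -[y]invgK; apply: GB => //; exact: GV.
split=> [|x y]; first by rewrite inE.
by rewrite !inE => Gx Gy; apply: GM => //; exact: GV.
Qed.

Definition subgroup_generated A : set gT := smallest is_subgroup A.

Definition finitely_generated G : Prop :=
  exists A, finite_set A /\ G = subgroup_generated A.

Definition normal_subgroup N G : Prop :=
  [/\ is_subgroup N, N `<=` G & forall x g, N x -> G g -> N (x ^ g)].

Definition simple_group G : Prop :=
  G <> [set 1] /\
  forall N, normal_subgroup N G -> N = [set 1] \/ N = G.

Definition has_order x (n : nat) : Prop :=
  [/\ 0 < n, x ^+ n = 1 & forall k, 0 < k < n -> x ^+ k <> 1].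

End Subgroups.

Definition vigorous (G : set (homeo cantor_space)) : Prop :=
  forall A B C : set cantor_space,
    clopen A -> clopen B -> clopen C ->
    B `<` A -> B !=set0 -> C `<` A -> C !=set0 ->
    exists g : homeo cantor_space,
      [/\ G g, g @` B `<=` C & forall x, ~ A x -> g x = x].

(* Main.v *)
Require Import Defs.
From mathcomp Require Import all_boot finmap zify.
From mathcomp Require Import boolp classical_sets cardinality topology cantor.

Set Implicit Arguments.
Unset Strict Implicit.
Unset Printing Implicit Defensive.

Local Open Scope classical_set_scope.

(* Cantor space is cut into a nonempty rest and finitely many copies ("cells") of
   itself, each embedded by a map that is piecewise in G.  A homeomorphism that
   permutes the cells and acts on each of them by an element of G lies in G as
   soon as its permutation is paired with its inverse on a second copy of the
   cells: it is then a product of commutators of homeomorphisms locally in G,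
   and simplicity and vigor put such commutators in G.

   Let h = a_1 ... a_r have infinite order, where the a_i generate G and satisfy
   a_i^m = 1 (elements of exponent m generate a normal subgroup).  Both alpha and
   beta are permutations of cells, and alpha carries in addition the twists h,
   h^-1, a_1, ..., a_r on the columns of two rows, together with a rotation of
   order m exchanging one cell ("the link") with the rest and the second copy.
   The product t = alpha beta acts by h on one cell and has bounded finite
   orbits elsewhere, so a power of t is a nontrivial element supported in that
   cell.  Words in alpha and beta return to that cell with holonomy a_i, hence
   the elements of <alpha, beta> supported in it contain, by simplicity, every
   commutator of elements of G supported in a smaller clopen set.  This property
   of a clopen set passes to images and to unions of overlapping sets; the images
   of the link cell cover the space, and compactness concludes. *)

(** * Combinatorics of the cells *)

(** Finite orders must coexist with a twist of infinite order. For alpha to have order m, the twists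
    along each cycle of columns must multiply to an element of exponent m; so h enters with h^-1 on
    the single m-cycle of [a_idx], and each a_i sits on a column of its own fixed by [a_idx].
    Following [a_idx] by the inverse cyclic shift cuts that cycle open: column 0 becomes fixed and
    keeps h, while h^-1 meets a_1, ..., a_r on one orbit and cancels against their product. This is
    what t does on row 0. On the other rows alpha undoes that map when its cycle of rows closes, and
    the first return of t to row 1 is conjugate to the pure shift, without any twist.

    The m-cycle and the n-cycle of rows share just the rows 0 and n-1, whence m + n - 2 rows; n >= 3
    keeps row 1 out of the m-cycle, so that alpha can permute the columns inside it. The m + r + 1
    columns are those of the m-cycle, one for each a_i, and a last one, fixed and untwisted, where
    the link commutes with the rest of alpha. *)

Lemma iter_period (V : eqType) (F : seq V) (f f' : V -> V) v :
  (forall v, v \in F -> f v \in F /\ f' (f v) = v) -> v \in F ->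
  exists j, 0 < j <= size F /\ iter j f v = v.
Proof.
move=> Ff vF.
have iF k : iter k f v \in F by elim: k => [//|k IHk]; case: (Ff _ IHk).
have [u|] := boolP (uniq (traject f v (size F).+1)).
  have := uniq_leq_size u (s2 := F); rewrite size_traject ltnn => H.
  by suff /H : {subset traject f v (size F).+1 <= F} by []; move=> _ /trajectP[i _ ->].
rewrite looping_uniq negbK => /trajectP[i ik e].
(* The orbit meets itself at the times i and [size F]; [f'] cancels the i steps common to both. *)
exists (size F - i); split; first by lia.
move: e; rewrite -{1}(subnKC (ltnW ik)); move: (size F - i)%N => j {ik}.
rewrite iterD; elim: i => [//|i IHi] /= e.
apply: IHi; have [_ <-] := Ff _ (iF i); rewrite -e.
by rewrite -iterD; have [_ ->] := Ff _ (iF (i + j)).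
Qed.

Lemma iter_can_in (V : eqType) (F : seq V) (f f' : V -> V) k v :
  (forall v, v \in F -> f v \in F /\ f' (f v) = v) -> v \in F ->
  iter k f' (iter k f v) = v.
Proof.
move=> Ff vF; have iF j : iter j f v \in F by elim: j => [//|j IHj]; case: (Ff _ IHj).
by elim: k => [//|k IHk]; rewrite iterSr [iter k.+1 f v]iterS; have [_ ->] := Ff _ (iF k).
Qed.

Section Index.
Variables m n r : nat.
Hypothesis m2 : 2 <= m.
Hypothesis n3 : 3 <= n.
Definition nb_rows := (m + n - 2)%N.
Definition nb_cols := (m + r).+1.
Local Notation s := nb_rows.
Local Notation L := nb_cols.

(* Cells are indexed by (row, column).  [a_idx] is an m-cycle on the first
   columns, [b_idx] is the full cyclic shift, and [s_idx] is [a_idx] followed by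
   the inverse shift. *)
Definition a_idx i := if i < m.-1 then i.+1 else if i == m.-1 then 0 else i.
Definition a_idx' i := if i == 0 then m.-1 else if i < m then i.-1 else i.
Definition b_idx i := if i < L.-1 then i.+1 else 0.
Definition b_idx' i := if i == 0 then L.-1 else i.-1.
Definition s_idx i := b_idx' (a_idx i).
Definition s_idx' i := a_idx' (b_idx i).

Lemma a_idxP i : i < L -> [/\ a_idx i < L, a_idx' i < L,
  a_idx' (a_idx i) = i & a_idx (a_idx' i) = i].
Proof.
by rewrite /a_idx /a_idx' /nb_cols => iL; split; repeat case: ifP; lia.
Qed.

Lemma b_idxP i : i < L -> [/\ b_idx i < L, b_idx' i < L,
  b_idx' (b_idx i) = i & b_idx (b_idx' i) = i].
Proof.
by rewrite /b_idx /b_idx' /nb_cols => iL; split; repeat case: ifP; lia.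
Qed.

Lemma iter_b_idx i : i < L -> iter L b_idx i = i.
Proof.
move=> iL; have shift k j : j + k < L -> iter k b_idx j = (j + k)%N.
  elim: k => [|k IHk] jk; first by rewrite addn0.
  rewrite iterS IHk; last by lia.
  by rewrite /b_idx; case: ifP; lia.
(* The orbit climbs to the last column, wraps to 0, and climbs back to i. *)
rewrite (_ : iter L b_idx i = iter i b_idx (b_idx (iter (L.-1 - i) b_idx i))).
  have iL1 : i <= L.-1 by move: iL; rewrite /nb_cols; lia.
  rewrite (shift (L.-1 - i)) subnKC //.
  by rewrite (_ : b_idx L.-1 = 0) ?shift// /b_idx ltnn.
rewrite -iterS -iterD (_ : (i + (L.-1 - i).+1)%N = L) //.
by move: iL; rewrite /nb_cols; lia.
Qed.

Lemma s_idxP i : i < L -> [/\ s_idx i < L, s_idx' i < L,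
  s_idx' (s_idx i) = i & s_idx (s_idx' i) = i].
Proof.
move=> iL; rewrite /s_idx /s_idx'.
have [a1 a2 a3 a4] := a_idxP iL; have [b1 b2 b3 b4] := b_idxP iL.
have [c1 c2 c3 c4] := a_idxP b1; have [d1 d2 d3 d4] := b_idxP a1.
by rewrite d4 c4.
Qed.

(* Rows 0, n-1, n, ..., s-1 form an m-cycle for alpha and rows 0, ..., n-1 an
   n-cycle for beta; they are arranged so that alpha beta is a cycle on the rows
   1, ..., s-1 and fixes row 0. *)
Definition alpha_idx (v : nat * nat) :=
  let: (w, i) := v in
  if w == 0 then (n.-1, s_idx i) else if w == 1 then (1, a_idx i)
  else if w < n.-1 then (w, i) else if w < s.-1 then (w.+1, i)
  else (0, s_idx' i).

Definition alpha_idx' (v : nat * nat) :=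
  let: (w, i) := v in
  if w == 0 then (s.-1, s_idx i) else if w == 1 then (1, a_idx' i)
  else if w < n.-1 then (w, i) else if w == n.-1 then (0, s_idx' i)
  else (w.-1, i).

Definition beta_idx (v : nat * nat) :=
  let: (w, i) := v in
  (if w < n.-1 then w.+1 else if w == n.-1 then 0 else w, i).

Definition beta_idx' (v : nat * nat) :=
  let: (w, i) := v in
  (if w == 0 then n.-1 else if w < n then w.-1 else w, i).

Definition indices := [seq (w, i) | w <- iota 0 s, i <- iota 0 L].

Lemma mem_indices w i : ((w, i) \in indices) = (w < s) && (i < L).
Proof.
apply/allpairsP/andP => [[[w' i'] []]|[ws iL]].
  by rewrite !mem_iota !add0n => + + [-> ->].
by exists (w, i); rewrite !mem_iota.
Qed.

Lemma beta_idxP v : v \in indices -> [/\ beta_idx v \in indices,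
  beta_idx' v \in indices, beta_idx' (beta_idx v) = v & beta_idx (beta_idx' v) = v].
Proof.
case: v => w i; rewrite /beta_idx /beta_idx' !mem_indices => /andP[ws ->].
rewrite !andbT; move: ws; rewrite /nb_rows => ws.
by split; try congr pair; repeat case: ifP; lia.
Qed.

Lemma alpha_idxP v : v \in indices -> [/\ alpha_idx v \in indices,
  alpha_idx' v \in indices, alpha_idx' (alpha_idx v) = v &
  alpha_idx (alpha_idx' v) = v].
Proof.
case: v => w i; rewrite mem_indices => /andP[ws iL].
have [a1 a2 a3 a4] := a_idxP iL; have [s1 s2 s3 s4] := s_idxP iL.
move: ws; rewrite /alpha_idx /alpha_idx' /nb_rows => ws.
have [w0|w0] := eqVneq w 0.
  rewrite w0 /=.
  have -> : (n.-1 == 0) = false by lia.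
  have -> : (n.-1 == 1) = false by lia.
  have -> : ((m + n - 2).-1 == 0) = false by lia.
  have -> : ((m + n - 2).-1 == 1) = false by lia.
  have -> : ((m + n - 2).-1 < n.-1) = false by lia.
  by rewrite !ltnn eqxx !mem_indices /nb_rows s1 s3 !andbT; split=> //; lia.
have [w1|w1] := eqVneq w 1.
  rewrite w1 /= !mem_indices /nb_rows a1 a2 a3 a4 !andbT; split=> //; lia.
have [wn|wn] := ltnP w n.-1.
  have -> : (w == 0) = false by lia.
  have -> : (w == 1) = false by lia.
  by rewrite wn mem_indices /nb_rows iL; split => //; lia.
split.
- by case: ifP; rewrite mem_indices /nb_rows ?iL ?s2; lia.
- by case: ifP; rewrite mem_indices /nb_rows ?iL ?s2; lia.
- case: (ltnP w (m + n - 2).-1) => wl.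
    have -> : (w.+1 == 0) = false by lia.
    have -> : (w.+1 == 1) = false by lia.
    have -> : (w.+1 < n.-1) = false by lia.
    by have -> : (w.+1 == n.-1) = false by lia.
  by rewrite /= s4; congr pair; lia.
- case: (eqVneq w n.-1) => wl.
    by rewrite /= s4 wl.
  have -> : (w.-1 == 0) = false by lia.
  have -> : (w.-1 == 1) = false by lia.
  have -> : (w.-1 < n.-1) = false by lia.
  have -> : (w.-1 < (m + n - 2).-1) by lia.
  by congr pair; lia.
Qed.

(** Beta moves freely among the rows below n. From row 0, one alpha and a descent by beta amount to
    [s_idx], which walks down from the last column to column m-1; [a_idx] on row 1 then gives the
    columns below m-1, and alpha climbs to the rows n and above. The three moves allowed are also
    available in the second copy, where they are realised by the inverse generators. *)
Lemma indices_connected (P : nat * nat -> Prop) :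
  (forall v, v \in indices -> P v ->
     [/\ P (alpha_idx v), P (beta_idx v) & P (beta_idx' v)]) ->
  P (1, L.-1) -> forall v, v \in indices -> P v.
Proof.
move=> step P1.
have st w i : w < s -> i < L -> P (w, i) ->
   [/\ P (alpha_idx (w, i)), P (beta_idx (w, i)) & P (beta_idx' (w, i))].
  by move=> ws iL; apply: step; rewrite mem_indices ws iL.
have s3 : 2 < s by rewrite /nb_rows; lia.
have L0 : 2 < L by rewrite /nb_cols; lia.
have ns : n <= s by rewrite /nb_rows; lia.
have down w i : w < n -> i < L -> P (w, i) -> P (0, i).
  elim: w => [//|w IHw] wn iL Pw; apply: IHw => //; first by lia.
  have [_ _] := st w.+1 i (leq_trans wn ns) iL Pw.
  by rewrite /beta_idx' /= wn.
have up w i : w < n -> i < L -> P (0, i) -> P (w, i).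
  move=> + iL P0; elim: w => [//|w IHw] wn.
  have [_ + _] := st w i (leq_trans (ltnW wn) ns) iL (IHw (ltnW wn)).
  by rewrite /beta_idx /=; have -> : w < n.-1 by lia.
(* The bound is where this walk ends: [L.-1 - r.+1] is column m-1. *)
have P0s k : k <= r.+1 -> P (0, L.-1 - k).
  elim: k => [_|k IHk kr]; first by rewrite subn0; apply: down P1; lia.
  have kL : L.-1 - k < L by lia.
  have [Pn _ _] := st 0 _ (leq_trans (isT : 0 < 3) s3) kL (IHk (ltnW kr)).
  have -> : (L.-1 - k.+1 = s_idx (L.-1 - k))%N.
    by rewrite /s_idx /b_idx' /a_idx /nb_cols; repeat case: ifP; lia.
  apply: down Pn; first by lia.
  by case: (s_idxP kL).
have P1i i : i < L -> P (1, i).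
  move=> iL; have [im|im] := leqP m.-1 i.
    apply: up => //; first by lia.
    have -> : i = (L.-1 - (L.-1 - i))%N by move: iL; rewrite /nb_cols; lia.
    by apply: P0s; move: iL; rewrite /nb_cols; lia.
  have mL : m.-1 < L by rewrite /nb_cols; lia.
  have Pm : P (1, m.-1).
    apply: up => //; first by lia.
    have -> : m.-1 = (L.-1 - r.+1)%N by rewrite /nb_cols; lia.
    exact: P0s.
  elim: i im iL => [_ _|i IHi im iL].
    have [+ _ _] := st 1 m.-1 (ltnW s3) mL Pm.
    by rewrite /alpha_idx /= /a_idx ltnn eqxx.
  have [+ _ _] := st 1 i (ltnW s3) (ltnW iL) (IHi (ltnW im) (ltnW iL)).
  by rewrite /alpha_idx /= /a_idx; have -> : i < m.-1 by lia.
have P_lt w i : w < n -> i < L -> P (w, i).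
  by move=> wn iL; apply: up => //; apply: (down 1) (P1i _ iL); lia.
move=> [w i]; rewrite mem_indices => /andP[ws iL].
have [wn|nw] := ltnP w n; first exact: P_lt.
elim: w ws nw => [|w IHw] ws nw; first by lia.
have Pw : P (w, i).
  have [wn|wn] := leqP n w; first by apply: IHw => //; exact: ltnW.
  exact: P_lt.
have [+ _ _] := st w i (ltnW ws) iL Pw.
rewrite /alpha_idx.
have -> : (w == 0) = false by lia.
have -> : (w == 1) = false by lia.
have -> : (w < n.-1) = false by lia.
by have -> : w < s.-1 by lia.
Qed.

End Index.

Notation CS := cantor_space.

(** * Clopen sets and homeomorphisms of Cantor space *)

Lemma cantor_separation (x y : CS) : x <> y ->
  exists U : set CS, [/\ clopen U, U x & ~ U y].
Proof. by move=> /eqP /cantor_zero_dimensional. Qed.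

Lemma cantor_separation3 (x y1 y2 y3 : CS) : x <> y1 -> x <> y2 -> x <> y3 ->
  exists U : set CS, [/\ clopen U, U x, ~ U y1, ~ U y2 & ~ U y3].
Proof.
move=> /cantor_separation[U1 [cU1 U1x U1y]] /cantor_separation[U2 [cU2 U2x U2y]].
move=> /cantor_separation[U3 [cU3 U3x U3y]].
exists (U1 `&` U2 `&` U3); split=> // [|[[]]|[[]]|[]] //.
by do 2!apply: clopenI => //.
Qed.

Lemma clopen_other_point (A : set CS) (x : CS) : clopen A -> A !=set0 ->
  exists y, A y /\ y <> x.
Proof.
move=> cA [y Ay]; have [xy|xy] := pselect (y = x); last by exists y.
apply/not_existsP => nz; apply: (perfectTP.1 cantor_perfect x).
suff <- : A = [set x] by case: cA.
rewrite eqEsubset; split=> [z Az|_ ->]; last by rewrite -xy.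
by have [//|zx] := pselect (z = x); case: (nz z).
Qed.

Lemma clopen_other_point3 (A : set CS) (x y z : CS) : clopen A -> A !=set0 ->
  exists p, [/\ A p, p <> x, p <> y & p <> z].
Proof.
move=> cA A0; have [p [Ap px]] := clopen_other_point x cA A0.
have [U [cU Up Ux]] := cantor_separation px.
have cAU : clopen (A `&` U) by exact: clopenI.
have [|q [[Aq Uq] qy]] := @clopen_other_point (A `&` U) y cAU; first by exists p.
have [V [cV Vq Vy]] := cantor_separation qy.
have cAUV : clopen (A `&` U `&` V) by exact: clopenI.
have [|r [[[Ar Ur] Vr] rz]] := @clopen_other_point (A `&` U `&` V) z cAUV.
  by exists q.
by exists r; split=> // e; [apply: Ux|apply: Vy]; rewrite -e.
Qed.

Lemma clopen_setC (A : set CS) : clopen A -> clopen (~` A).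
Proof. exact: (@clopenC _ A set0). Qed.

Lemma clopenD (A B : set CS) : clopen A -> clopen B -> clopen (A `\` B).
Proof. by move=> cA cB; apply: clopenI => //; exact: clopen_setC. Qed.

Lemma cantor_finite_cover (V : CS -> set CS) :
  (forall x, open (V x)) -> (forall x, V x x) ->
  exists s : seq CS, forall x, exists2 y, y \in s & V y x.
Proof.
move=> oV Vx; have := cantor_space_compact; rewrite compact_cover.
move=> /(_ CS setT V (fun x _ => oV x)); case.
  by move=> x _; exists x.
move=> D _ cov; exists (enum_fset D) => x.
by have [//|y /= Dy Vyx] := cov x; exists y.
Qed.

(** An induction principle drawn from compactness: finitely many sets [V] cover the space, and a
    clopen set is cut along them, one at a time, into disjoint pieces. *)
Lemma clopen_ind (P : set CS -> Prop) :
  (forall x, exists V, [/\ clopen V, V x &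
     forall U, clopen U -> U `<=` V -> P U]) ->
  (forall U1 U2, clopen U1 -> clopen U2 -> (forall x, U1 x -> ~ U2 x) ->
     P U1 -> P U2 -> P (U1 `|` U2)) ->
  forall U, clopen U -> P U.
Proof.
move=> loc un; have [V HV] := choice loc.
have [||s sV] := @cantor_finite_cover V.
- by move=> x; case: (HV x) => -[].
- by move=> x; case: (HV x).
suff H U : clopen U -> (forall x, U x -> exists2 y, y \in s & V y x) -> P U.
  by move=> U cU; apply: H.
elim: {sV}s U => [|y s IHs] U cU Us.
  (* With no covering set left [U] is empty, so the neighbourhood of an arbitrary point serves. *)
  have [_ _] := HV point; apply=> // x /Us[]//.
have cV : clopen (V y) by case: (HV y).
rewrite -(setUIDK U (V y)); apply: un.
- exact: clopenI.
- exact: clopenD.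
- by move=> x [_ ?] [].
- have [_ _] := HV y; apply; first exact: clopenI.
  by move=> x [].
- apply: IHs; first exact: clopenD.
  move=> x [/Us[z]]; rewrite inE => /orP[/eqP->//|zs Vz _]; by exists z.
Qed.

Section Action.
Local Open Scope group_scope.
Implicit Types (f g : homeo CS) (A B U : set CS).

Lemma homeo_mulE f g x : (f * g) x = g (f x). Proof. by []. Qed.
Lemma homeo_mulKx f x : f^-1 (f x) = x. Proof. exact: homeo_funK. Qed.
Lemma homeo_mulVKx f x : f (f^-1 x) = x. Proof. exact: homeo_invK. Qed.
Lemma homeo_inj f : injective f. Proof. exact: can_inj (@homeo_funK _ f). Qed.
(** Encoded as the preimage under the inverse, so that membership unfolds without an existential;
    [imE] recovers the direct image. *)
Definition im f A : set CS := [set y | A (f^-1 y)].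

Lemma imP f A x : im f A (f x) <-> A x.
Proof. by rewrite /im /mkset homeo_mulKx. Qed.

Lemma imE f A : im f A = f @` A.
Proof.
rewrite eqEsubset; split=> [y Ay|_ [x Ax <-]]; last exact/imP.
by exists (f^-1 y) => //; rewrite homeo_mulVKx.
Qed.

Lemma im_clopen f A : clopen A -> clopen (im f A).
Proof. by move=> cA; apply: preimage_clopen => // x; exact: homeo_continuous. Qed.

Lemma pre_clopen f A : clopen A -> clopen [set x | A (f x)].
Proof. by move=> cA; apply: preimage_clopen => // x; exact: homeo_continuous. Qed.

Definition supp_in A f : Prop := forall x, ~ A x -> f x = x.

Lemma supp_inV A f : supp_in A f -> supp_in A f^-1.
Proof. by move=> sf x Ax; apply: (@homeo_inj f); rewrite homeo_mulVKx sf. Qed.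

Lemma supp_inM A f g : supp_in A f -> supp_in A g -> supp_in A (f * g).
Proof. by move=> sf sg x Ax; rewrite homeo_mulE sf// sg. Qed.

Lemma supp_inW A B f : A `<=` B -> supp_in A f -> supp_in B f.
Proof. by move=> AB sf x Bx; apply: sf => /AB. Qed.

Lemma supp_in_stable A f x : supp_in A f -> A x -> A (f x).
Proof.
move=> sf Ax; have [//|nA] := pselect (A (f x)).
by have := sf _ nA => /homeo_inj fx; rewrite fx in nA.
Qed.

Lemma supp_inJ A f g : supp_in A f -> supp_in (im g A) (f ^ g).
Proof.
by move=> sf x Ax; rewrite conjgE !homeo_mulE sf// homeo_mulVKx.
Qed.

Lemma conjE f g x : (f ^ g) (g x) = g (f x).
Proof. by rewrite conjgE !homeo_mulE homeo_mulKx. Qed.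

Lemma disjoint_commute A B f g : (forall x, A x -> ~ B x) ->
  supp_in A f -> supp_in B g -> commute f g.
Proof.
move=> AB sf sg; apply: homeoP => x; rewrite !homeo_mulE.
have [Ax|nAx] := pselect (A x).
  rewrite (sg x); last exact: AB.
  by rewrite sg//; apply: AB; exact: supp_in_stable.
rewrite (sf x)// sf// => Agx; apply: nAx.
have [Bx|nBx] := pselect (B x); last by rewrite sg in Agx.
by case: (AB _ Agx); exact: supp_in_stable.
Qed.

Lemma supp_inR A f g : supp_in A f -> supp_in A g -> supp_in A [~ f, g].
Proof.
move=> sf sg; rewrite commgEl conjgE; do !apply: supp_inM => //; exact: supp_inV.
Qed.

End Action.

Local Open Scope group_scope.

(** * Simple vigorous groups *)

Section Generation.
Variable gT : groupType.
Implicit Types (G K X : set gT) (x y g : gT).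

Lemma subgroup1 K : is_subgroup K -> K 1.
Proof. by case/is_subgroupP. Qed.

Lemma subgroupM K x y : is_subgroup K -> K x -> K y -> K (x * y).
Proof. by case/is_subgroupP=> _ + _; apply. Qed.

Lemma subgroupV K x : is_subgroup K -> K x -> K x^-1.
Proof. by case/is_subgroupP=> _ _; apply. Qed.

Lemma subgroupJ K x y : is_subgroup K -> K x -> K y -> K (x ^ y).
Proof.
by move=> sK Kx Ky; rewrite conjgE; do !apply: subgroupM => //; exact: subgroupV.
Qed.

Lemma subgroupR K x y : is_subgroup K -> K x -> K y -> K [~ x, y].
Proof.
move=> sK Kx Ky; rewrite commgEl; apply: subgroupM => //; first exact: subgroupV.
exact: subgroupJ.
Qed.

Lemma subgroupX K x k : is_subgroup K -> K x -> K (x ^+ k).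
Proof.
move=> sK Kx; elim: k => [|k IHk]; first exact: subgroup1.
by rewrite expgS; exact: subgroupM.
Qed.

Lemma generated_is_subgroup X : is_subgroup (subgroup_generated X).
Proof.
apply/is_subgroupP; split=> [K [sK _]|x y Kx Ky K [sK XK]|x Kx K [sK XK]].
- exact: subgroup1.
- by apply: subgroupM => //; [exact: Kx|exact: Ky].
- by apply: subgroupV => //; exact: Kx.
Qed.

Lemma sub_generated X : X `<=` subgroup_generated X.
Proof. by move=> x Xx K [_]; apply. Qed.

Lemma generated_sub X K : is_subgroup K -> X `<=` K -> subgroup_generated X `<=` K.
Proof. by move=> sK XK x; apply. Qed.

(** Invariance under conjugation makes the subgroup generated by [X] normal in [G], and it is not
    trivial. Every later use of simplicity goes through this form. *)
Lemma simple_gen G X K : is_subgroup G -> simple_group G -> X `<=` G ->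
  (forall x g, X x -> G g -> X (x ^ g)) -> (exists x, X x /\ x <> 1) ->
  is_subgroup K -> X `<=` K -> G `<=` K.
Proof.
move=> sG [_ simpG] XG XJ [x [Xx x1]] sK XK.
have sN := generated_is_subgroup X.
have NJ y g : subgroup_generated X y -> G g -> subgroup_generated X (y ^ g).
  move=> Ny Gg; suff: [set z | subgroup_generated X (z ^ g)] y by [].
  apply: Ny; split.
    apply/is_subgroupP; split=> [|u v Nu Nv|u Nu] /=.
    - by rewrite conj1g; exact: (subgroup1 sN).
    - by rewrite conjMg; exact: (subgroupM sN Nu Nv).
    - by rewrite conjVg; exact: (subgroupV sN Nu).
  by move=> z Xz; exact: (sub_generated (XJ z g Xz Gg)).
have nN : normal_subgroup (subgroup_generated X) G.
  by split=> //; exact: generated_sub.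
case: (simpG _ nN) => [N1|<-]; last exact: generated_sub.
by case: x1; have := @sub_generated X x Xx; rewrite N1.
Qed.

End Generation.

Section Vigorous.
Variable G : set (homeo CS).
Hypothesis Gsub : is_subgroup G.
Hypothesis Gsimple : simple_group G.
Hypothesis Gvig : vigorous G.
Implicit Types (f g h : homeo CS) (A B U V W P X : set CS) (x y : CS).

Lemma vigorousP A B P : clopen A -> clopen B -> clopen P ->
  B `<=` A -> P `<=` A -> B !=set0 -> P !=set0 ->
  (exists x, A x /\ ~ B x) -> (exists x, A x /\ ~ P x) ->
  exists g, [/\ G g, forall x, B x -> P (g x) & supp_in A g].
Proof.
move=> cA cB cP BA PA B0 P0 [b [Ab nBb]] [p [Ap nPp]].
have [||g [Gg gB gA]] := Gvig cA cB cP _ B0 _ P0.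
- by split=> // /(_ _ Ab).
- by split=> // /(_ _ Ap).
by exists g; split=> // x Bx; apply: gB; exists x.
Qed.

Lemma clopen_nontrivial A : clopen A -> A !=set0 ->
  exists g, [/\ G g, supp_in A g & exists x, A x /\ g x <> x].
Proof.
move=> cA A0; have [x Ax] := A0; have [y [Ay yx]] := clopen_other_point x cA A0.
have [U [cU Ux Uy]] := cantor_separation (nesym yx).
have [|||||||||g [Gg gU sg]] := @vigorousP A (A `&` U) (A `\` U) => //.
- exact: clopenI.
- exact: clopenD.
- by exists x.
- by exists y.
- by exists y; split=> // -[].
- by exists x; split=> // -[].
exists g; split=> //; exists x; split=> // gx.
by have [//|_] := gU x; rewrite gx.
Qed.

(** If [f] displaces [U] off itself and [g], supported in [U], moves a point y of [U], then [g]
    fixes f y, so the two products differ at y. *)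
Lemma clopen_noncommuting A : clopen A -> A !=set0 ->
  exists f g, [/\ G f, G g, supp_in A f, supp_in A g & [~ f, g] <> 1].
Proof.
move=> cA A0; have [f [Gf sf [x [Ax fx]]]] := clopen_nontrivial cA A0.
have [V [cV Vx Vfx]] := cantor_separation (nesym fx).
pose U := A `&` V `&` [set y | ~ V (f y)].
have cU : clopen U.
  apply: clopenI; first exact: clopenI.
  exact: (pre_clopen f (clopen_setC cV)).
have [||g [Gg sg [y [Uy gy]]]] := @clopen_nontrivial U => //; first by exists x.
exists f, g; split=> //; first by apply: supp_inW sg => z [[]].
move=> fg1; have : g (f y) = f (g y).
  by rewrite -!homeo_mulE commgC fg1 mulg1.
rewrite sg => [/homeo_inj /esym//|[[_ + _]]].
by case: Uy => _.
Qed.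

Definition small f : Prop :=
  G f /\ exists A, [/\ clopen A, exists x, ~ A x & supp_in A f].

(* Conjugating by an element that fixes [U] and [g U] pointwise and pushes the
   rest of the support of [g] into [P]. *)
Lemma small_local g P x : small g -> clopen P -> P !=set0 ->
  exists V, [/\ clopen V, V x & forall U, clopen U -> U `<=` V ->
    exists h, [/\ G h, forall y, U y -> h y = g y &
      supp_in (U `|` im g U `|` P) h]].
Proof.
move=> [Gg [B [cB [b0 nBb0] sg]]] cP P0.
have cnB : clopen (~` B) by exact: clopen_setC.
(* The point p lies in [P], the point c outside the support [B], and both survive in [A] because
   they avoid x and g x. They make [P] cut by [D] and [A] a nonempty proper part of [A], and [B] cut
   by [A] a proper part, as vigor demands. *)
have [p [Pp px pgx _]] := clopen_other_point3 x (g x) x cP P0.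
have [|c [nBc cx cgx cp]] := clopen_other_point3 x (g x) p cnB; first by exists b0.
have [V1 [cV1 V1x V1p V1c _]] :=
  cantor_separation3 (nesym px) (nesym cx) (nesym px).
have [V2 [cV2 V2x V2p V2c _]] :=
  cantor_separation3 (nesym pgx) (nesym cgx) (nesym pgx).
have [D [cD Dp nDc]] := cantor_separation (nesym cp).
exists (V1 `&` [set y | V2 (g y)]); split=> //.
  by apply: clopenI => //; exact: pre_clopen.
move=> U cU UV; have cgU := im_clopen g cU.
have gUV2 y : im g U y -> V2 y.
  by move=> /UV[_ /=]; rewrite homeo_mulVKx.
pose A := ~` (U `|` im g U).
have cA : clopen A by apply: clopen_setC; exact: clopenU.
have Ap : A p.
  by move=> [/UV[]|/gUV2].
have Ac : A c.
  by move=> [/UV[]|/gUV2].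
have [B0|nB0] := pselect ((B `&` A) !=set0); last first.
  exists g; split=> //; apply: supp_inW sg => y By; left.
  have [//|nUy] := pselect ((U `|` im g U) y).
  by case: nB0; exists y.
have [|||||||||f [Gf fB sf]] := @vigorousP A (B `&` A) (P `&` D `&` A) => //.
- exact: clopenI.
- by apply: clopenI => //; exact: clopenI.
- by exists p; split.
- by exists c; split=> // -[].
- by exists c; split=> // -[[]].
exists (g ^ f); split; first exact: subgroupJ.
- move=> y Uy; have fy : f y = y by apply: sf => nU; apply: nU; left.
  rewrite -{1}fy conjE; apply: sf => nU; apply: nU; right; exact/imP.
- move=> y nUy; have : ~ im f B y.
    move=> Bfy; apply: nUy; have := Bfy; rewrite -{1}(homeo_mulVKx f y) imP => By.
    have [Afy|nAfy] := pselect (A (f^-1 y)).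
      have [|[Py _] _] := fB (f^-1 y); first by split.
      by right; rewrite homeo_mulVKx in Py.
    have fy : f (f^-1 y) = f^-1 y by exact: sf.
    rewrite homeo_mulVKx in fy; rewrite -fy in nAfy.
    by left; exact: contrapT nAfy.
  exact: supp_inJ.
Qed.

Lemma small_nontrivial : exists g, small g /\ g <> 1.
Proof.
have [z [_ zN]] := clopen_other_point point clopenT (ex_intro _ point I).
have [U [cU Uz nU]] := cantor_separation zN.
have [|g [Gg sg [x [_ gx]]]] := @clopen_nontrivial U cU; first by exists z.
exists g; split; last by move=> g1; apply: gx; rewrite g1.
by split=> //; exists U; split=> //; exists point.
Qed.

(** The elements with this property are closed under conjugation, and only the closure under
    products is delicate: two small supports may together cover the space. Both factors are
    therefore first cut down by [small_local] to small neighbourhoods, their images and one common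
    set [P], all of which miss a point c. *)
Lemma small_germ g x : G g ->
  exists h U, [/\ small h, clopen U, U x & forall y, U y -> h y = g y].
Proof.
pose T := [set g | G g /\ forall x, exists h U,
  [/\ small h, clopen U, U x & forall y, U y -> h y = g y]].
suff GT : G `<=` T by move=> /GT[_].
have smallV h : small h -> small h^-1.
  move=> [Gh [A [cA nA sh]]]; split; first exact: subgroupV.
  by exists A; split=> //; exact: supp_inV.
have smallJ h g' : small h -> G g' -> small (h ^ g').
  move=> [Gh [A [cA [a nA] sh]]] Gg; split; first exact: subgroupJ.
  exists (im g' A); split; [exact: im_clopen|exists (g' a); by rewrite imP|].
  exact: supp_inJ.
apply: (@simple_gen _ G T T) => //.
- by move=> ? [].
- move=> h g' [Gh Th] Gg'; split; first exact: subgroupJ.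
  move=> y; have [k [U [sk cU Uy kU]]] := Th (g'^-1 y).
  exists (k ^ g'), (im g' U); split=> //; first exact: smallJ.
    exact: im_clopen.
  move=> u Uu; rewrite -{1 2}(homeo_mulVKx g' u) !conjE kU//.
- have [h [sh h1]] := small_nontrivial; exists h; split=> //.
  split; first by case: sh.
  by move=> y; exists h, setT; split=> //; exact: clopenT.
apply/is_subgroupP; split.
- split=> [|y]; first exact: subgroup1.
  have [z [_ zN]] := clopen_other_point y clopenT (ex_intro _ point I).
  have [U [cU Uz nU]] := cantor_separation zN.
  exists 1, setT; split=> //; last exact: clopenT.
  split; first exact: subgroup1.
  by exists U; split=> //; exists y.
- move=> f h [Gf Tf] [Gh Th]; split=> [|y]; first exact: subgroupM.
  have [f1 [U1 [sf1 cU1 U1y f1U]]] := Tf y.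
  have [h1 [U2 [sh1 cU2 U2y h1U]]] := Th (f y).
  have [c [_ cy cfy chfy]] := clopen_other_point3 y (f y) (h (f y)) clopenT
    (ex_intro _ point I).
  have [N [cN Nc Ny Nfy Nhfy]] := cantor_separation3 cy cfy chfy.
  have [p [_ pc]] := clopen_other_point c clopenT (ex_intro _ point I).
  have [P [cP Pp nPc]] := cantor_separation pc.
  have P0 : P !=set0 by exists p.
  have [V1 [cV1 V1y HV1]] := small_local y sf1 cP P0.
  have [V2 [cV2 V2y HV2]] := small_local (f y) sh1 cP P0.
  have cNN : clopen (~` N) by exact: clopen_setC.
  have f1y : f1 y = f y by exact: f1U.
  have h1y : h1 (f y) = h (f y) by exact: h1U.
  pose W2 := U2 `&` V2 `&` ~` N `&` [set z | (~` N) (h1 z)].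
  have cW2 : clopen W2.
    by apply: clopenI; [apply: clopenI => //; exact: clopenI|exact: pre_clopen].
  have W2y : W2 (f y).
    by split; [split; [split|]|] => //; rewrite /mkset h1y.
  pose W1 := U1 `&` V1 `&` ~` N `&` [set z | W2 (f1 z)].
  have cW1 : clopen W1.
    by apply: clopenI; [apply: clopenI => //; exact: clopenI|exact: pre_clopen].
  have W1y : W1 y.
    by split; [split; [split|]|] => //; rewrite /mkset f1y.
  have [|f2 [Gf2 f2W sf2]] := HV1 W1 cW1; first by move=> z [[[]]].
  have [|h2 [Gh2 h2W sh2]] := HV2 W2 cW2; first by move=> z [[[]]].
  exists (f2 * h2), W1; split=> //.
    split; first exact: subgroupM.
    exists ((W1 `|` im f1 W1 `|` P) `|` (W2 `|` im h1 W2 `|` P)); split.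
    - by do !apply: clopenU => //; exact: im_clopen.
    - have W1c z : (W1 z -> z <> c) /\ (im f1 W1 z -> z <> c).
        split=> [[[_ nN] _] zc|[_]]; first by apply: nN; rewrite zc.
        rewrite /mkset homeo_mulVKx => -[[_ nN] _] zc; by apply: nN; rewrite zc.
      have W2c z : (W2 z -> z <> c) /\ (im h1 W2 z -> z <> c).
        split=> [[[_ nN] _] zc|[_]]; first by apply: nN; rewrite zc.
        rewrite /mkset homeo_mulVKx => nN zc; by apply: nN; rewrite zc.
      exists c => -[[[/(proj1 (W1c _))|/(proj2 (W1c _))]|]|
        [[/(proj1 (W2c _))|/(proj2 (W2c _))]|]] //.
    - apply: supp_inM; [apply: supp_inW sf2|apply: supp_inW sh2].
      + by move=> z; left.
      + by move=> z; right.
  move=> z W1z; rewrite !homeo_mulE f2W//.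
  case: (W1z) => [[[U1z _] _] W2z].
  by rewrite -(f1U z)// h2W// h1U//; case: W2z => [[[]]].
- move=> f [Gf Tf]; split=> [|y]; first exact: subgroupV.
  have [f1 [U1 [sf1 cU1 U1y f1U]]] := Tf (f^-1 y).
  exists f1^-1, (im f U1); split=> //; first exact: smallV.
    exact: im_clopen.
  move=> z Uz; apply: (@homeo_inj f1); rewrite homeo_mulVKx f1U//.
  by rewrite homeo_mulVKx.
Qed.
End Vigorous.

(** Factors that commute with all the others drop out of a commutator; in [locG_commg] they are the
    uncontrolled parts of two extensions. *)
Lemma commg_mul_commute (gT : groupType) (f j f' j' : gT) :
  commute j f -> commute j f' -> commute j j' -> commute j' f -> commute j' f' ->
  [~ f * j, f' * j'] = [~ f, f'].
Proof.
move=> jf jf' jj' j'f j'f'.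
have fixJ (x y : gT) : commute y x -> x ^ y = x.
  by move=> yx; rewrite conjgE -yx mulKg.
have cR (y : gT) : commute y f -> commute y f' -> commute y [~ f, f'].
  move=> yf yf'; rewrite commgEl conjgE; do !apply: commuteM => //; exact: commuteV.
have e1 : j ^ f' = j by apply/fixJ/commute_sym.
have e2 : j ^ j' = j by apply/fixJ/commute_sym.
have e3 : (f ^ f') ^ j' = f ^ f'.
  by apply: fixJ; rewrite conjgE; do !apply: commuteM => //; exact: commuteV.
have -> : [~ f * j, f' * j'] = (f * j)^-1 * (f ^ f' * j).
  by rewrite commgEl conjMg !conjgM e1 e2 e3.
rewrite invgM -mulgA (mulgA f^-1) -commgEl.
by rewrite -(cR j jf jf') mulKg.
Qed.

(** * Homeomorphisms locally in [G] *)

Section LocalGroup.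
Variable G : set (homeo CS).
Hypothesis Gsub : is_subgroup G.
Hypothesis Gsimple : simple_group G.
Hypothesis Gvig : vigorous G.
Implicit Types (f g h : homeo CS) (A B U V W P X : set CS) (x y : CS).

Lemma germ_local g P x : G g -> clopen P -> P !=set0 ->
  exists V, [/\ clopen V, V x & forall U, clopen U -> U `<=` V ->
    exists h, [/\ G h, forall y, U y -> h y = g y &
      supp_in (U `|` im g U `|` P) h]].
Proof.
move=> Gg cP P0.
have [k [U0 [sk cU0 U0x kU0]]] := small_germ Gsub Gsimple Gvig x Gg.
have [V [cV Vx HV]] := small_local Gsub Gvig x sk cP P0.
exists (V `&` U0); split=> //; first exact: clopenI.
move=> U cU UV; have [|h [Gh hU sh]] := HV U cU; first by move=> y /UV[].
have kg y : U y -> k y = g y by move=> /UV[_ /kU0].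
exists h; split=> // [y Uy|]; first by rewrite hU// kg.
apply: supp_inW sh => y [[|]|]; [by left; left| |by right].
by rewrite /im /mkset => Uy; left; right; rewrite -{1}(homeo_mulVKx k y) kg// homeo_mulKx.
Qed.

(** This describes the topological full group of [G], which may be larger than [G]. *)
Definition locG f : Prop := forall x, exists g U,
  [/\ G g, clopen U, U x & forall y, U y -> f y = g y].

Lemma locG_sub f : G f -> locG f.
Proof. by move=> Gf x; exists f, setT; split=> //; exact: clopenT. Qed.

Lemma locG_mul f g : locG f -> locG g -> locG (f * g).
Proof.
move=> lf lg x; have [f1 [U [Gf1 cU Ux fU]]] := lf x.
have [g1 [V [Gg1 cV Vfx gV]]] := lg (f x).
exists (f1 * g1), (U `&` [set y | V (f y)]); split=> //.
- exact: subgroupM.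
- by apply: clopenI => //; exact: pre_clopen.
- by move=> y [Uy Vfy]; rewrite !homeo_mulE gV// fU.
Qed.

(** Local extensions multiply without interfering: since f moves [A] off itself and everything stays
    away from [P], the extension for one piece fixes whatever the extension for the other piece has
    to carry. *)
Lemma locG_disjoint_extension f A P : locG f -> clopen A -> clopen P ->
  P !=set0 -> (forall x, A x -> [/\ ~ A (f x), ~ P x & ~ P (f x)]) ->
  exists h, [/\ G h, forall y, A y -> h y = f y &
    supp_in (A `|` im f A `|` P) h].
Proof.
move=> lf cA cP P0 AfA; suff /(_ A) : forall U, clopen U -> U `<=` A ->
    exists h, [/\ G h, forall y, U y -> h y = f y &
    supp_in (U `|` im f U `|` P) h] by apply.
apply: clopen_ind => [x|U1 U2 cU1 cU2 U12 IH1 IH2 UA].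
  have [g [U0 [Gg cU0 U0x fg]]] := lf x.
  have [V [cV Vx HV]] := germ_local x Gg cP P0.
  exists (V `&` U0); split=> //; first exact: clopenI.
  move=> U cU UV UA; have [|h [Gh hU sh]] := HV U cU; first by move=> y /UV[].
  have fg' y : U y -> f y = g y by move=> /UV[_ /fg].
  exists h; split=> // [y Uy|]; first by rewrite hU// fg'.
  apply: supp_inW sh => y [[|]|]; [by left; left| |by right].
  rewrite /im /mkset => Uy; left; right.
  by rewrite -{1}(homeo_mulVKx g y) -fg'// homeo_mulKx.
have [|h1 [Gh1 h1U sh1]] := IH1; first by move=> y U1y; apply: UA; left.
have [|h2 [Gh2 h2U sh2]] := IH2; first by move=> y U2y; apply: UA; right.
have A1 y : U1 y -> A y by move=> U1y; apply: UA; left.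
have A2 y : U2 y -> A y by move=> U2y; apply: UA; right.
exists (h1 * h2); split=> [|y|]; first exact: subgroupM.
  case=> Uy; rewrite homeo_mulE.
    rewrite h1U// sh2// => -[[U2fy|]|].
    + by have [/(_ (A2 _ U2fy))] := AfA y (A1 _ Uy).
    + by rewrite imP; exact: U12.
    + by have [_ _] := AfA y (A1 _ Uy).
  rewrite sh1 ?h2U// => -[[U1y|]|].
  + exact: U12 Uy.
  + rewrite /im /mkset => U1y; have [+ _ _] := AfA _ (A1 _ U1y).
    by rewrite homeo_mulVKx; apply; exact: A2.
  + by have [_ + _] := AfA y (A2 _ Uy).
apply: supp_inM; [apply: supp_inW sh1|apply: supp_inW sh2] => y [[]|].
- by left; left; left.
- by left; right; left.
- by right.
- by left; left; right.
- by left; right; right.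
- by right.
Qed.

Lemma clopen_split P : clopen P -> P !=set0 ->
  exists U, [/\ clopen U, U `<=` P, U !=set0 & P `\` U !=set0].
Proof.
move=> cP [p Pp]; have [q [Pq qp]] := clopen_other_point p cP (ex_intro _ p Pp).
have [U [cU Uq Up]] := cantor_separation qp.
exists (P `&` U); split; [exact: clopenI|by move=> ? []|by exists q|].
by exists p; split=> // -[].
Qed.

(** Here f preserves [X], so the previous lemma does not apply to it. But f is (f g) g^-1 with g in
    [G] pushing [X] into [P], and both f g and g displace [X] off itself. *)
Lemma locG_extension f X P : locG f -> clopen X -> supp_in X f -> clopen P ->
  P !=set0 -> (forall x, X x -> ~ P x) ->
  exists h, [/\ G h, forall y, X y -> h y = f y & supp_in (X `|` P) h].
Proof.
move=> lf cX sf cP P0 XP.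
have [X0|X0] := pselect (X !=set0); last first.
  exists 1; split; [exact: subgroup1|by move=> y Xy; case: X0; exists y|by []].
(* [P1] receives the image of [X]; the rest of [P] absorbs the uncontrolled parts of the two
   extensions. *)
have [P1 [cP1 P1P P10 P20]] := clopen_split cP P0.
have [p1 P1p1] := P10; have [p2 [Pp2 nP1p2]] := P20.
have [|||||||||g [Gg gX _]] := @vigorousP G Gvig setT X P1 => //.
- exact: clopenT.
- by exists p1; split=> // Xp; apply: (XP p1) => //; exact: P1P.
- by exists p2.
have cP2 : clopen (P `\` P1) by exact: clopenD.
have gXX x : X x -> ~ X (g x) by move=> /gX/P1P + /XP.
have gP2 x : X x -> ~ (P `\` P1) (g x) by move=> /gX ? [].
have [|h1 [Gh1 h1X sh1]] :=
    locG_disjoint_extension (locG_sub Gg) cX cP2 P20.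
  by move=> x Xx; split; [exact: gXX|case=> /(XP x)|exact: gP2].
have fX x : X x -> X (f x) by exact: supp_in_stable.
have [|h2 [Gh2 h2X sh2]] :=
    locG_disjoint_extension (locG_mul lf (locG_sub Gg)) cX cP2 P20.
  by move=> x Xx; split; [exact/gXX/fX|case=> /(XP x)|exact/gP2/fX].
exists (h2 * h1^-1); split.
- by apply: subgroupM => //; exact: subgroupV.
- move=> y Xy; rewrite homeo_mulE; apply: (@homeo_inj h1).
  by rewrite homeo_mulVKx h2X// h1X; last exact: fX.
- apply: supp_inM; [apply: supp_inW sh2|apply/supp_inV/(supp_inW _ sh1)] => y [[]|].
  + by left.
  + rewrite /im /mkset => Xy; right; apply: P1P.
    rewrite -(homeo_mulVKx (f * g) y); apply/gX/fX => //.
  + by case=> ?; right.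
  + by left.
  + by rewrite /im /mkset => /gX; rewrite homeo_mulVKx => /P1P; right.
  + by case=> ?; right.
Qed.

(** Extend f and g to elements of [G] whose uncontrolled parts live in disjoint pieces of the
    complement of [X]. Those parts commute with all else, so the commutator does not change. *)
Lemma locG_commg f g X : locG f -> locG g -> clopen X -> supp_in X f ->
  supp_in X g -> (exists x, ~ X x) -> G [~ f, g].
Proof.
move=> lf lg cX sf sg [x nXx].
have cP := clopen_setC cX.
have [|P1 [cP1 P1P P10 P20]] := clopen_split cP; first by exists x.
have cP2 : clopen (~` X `\` P1) by exact: clopenD.
have [|f1 [Gf1 f1X sf1]] := locG_extension lf cX sf cP1 P10.
  by move=> y Xy /P1P.
have [|g1 [Gg1 g1X sg1]] := locG_extension lg cX sg cP2 P20.
  by move=> y Xy [].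
have junk (k k1 : homeo CS) P : supp_in X k -> (forall y, X y -> k1 y = k y) ->
    supp_in (X `|` P) k1 -> supp_in P (k^-1 * k1).
  move=> sk k1X sk1 y nPy; rewrite homeo_mulE.
  have [Xy|nXy] := pselect (X y).
    by rewrite k1X ?homeo_mulVKx//; apply: supp_in_stable Xy; exact: supp_inV.
  by rewrite (supp_inV sk)// sk1// => -[].
have sj := junk _ _ _ sf f1X sf1; have sj' := junk _ _ _ sg g1X sg1.
have <- : [~ f * (f^-1 * f1), g * (g^-1 * g1)] = [~ f, g].
  apply: commg_mul_commute.
  - by apply: disjoint_commute sj sf => y /P1P.
  - by apply: disjoint_commute sj sg => y /P1P.
  - by apply: disjoint_commute sj sj' => y P1y [].
  - by apply: disjoint_commute sj' sf => y [].
  - by apply: disjoint_commute sj' sg => y [].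
by rewrite !mulVKg; exact: subgroupR.
Qed.

Definition local_commutators : set (homeo CS) := [set c | exists f g W,
  [/\ G f, G g, clopen W & [/\ exists x, ~ W x, supp_in W f, supp_in W g &
  c = [~ f, g]]]].

Lemma local_commutators_gen K :
  is_subgroup K -> local_commutators `<=` K -> G `<=` K.
Proof.
move=> sK; apply: simple_gen => //.
- by move=> _ [f [g [W [Gf Gg cW [_ _ _ ->]]]]]; exact: subgroupR.
- move=> _ h [f [g [W [Gf Gg cW [[x nWx] sf sg ->]]]]] Gh.
  exists (f ^ h), (g ^ h), (im h W); split; [exact: subgroupJ|exact: subgroupJ|
    exact: im_clopen|split].
  + by exists (h x); rewrite imP.
  + exact: supp_inJ.
  + exact: supp_inJ.
  + exact: conjRg.
- have [z [_ zN]] := clopen_other_point point clopenT (ex_intro _ point I).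
  have [U [cU Uz nU]] := cantor_separation zN.
  have [|f [g [Gf Gg sf sg fg]]] := clopen_noncommuting Gvig cU; first by exists z.
  by exists [~ f, g]; split=> //; exists f, g, U; split=> //; split=> //; exists point.
Qed.

End LocalGroup.

(** * Clopen sets filled by a subgroup *)

Section Filling.
Variable G : set (homeo CS).
Hypothesis Gsub : is_subgroup G.
Hypothesis Gsimple : simple_group G.
Hypothesis Gvig : vigorous G.
Variable H : set (homeo CS).
Hypothesis Hsub : is_subgroup H.
Hypothesis HG : H `<=` G.
Implicit Types (f g h : homeo CS) (A B D U V W P X Q : set CS) (x y : CS).

(** Only commutators are asked for: seen through the embedding of a cell, elements of [G] become
    homeomorphisms locally in [G], and only their commutators are known to lie in [G] again. That
    [W'] is proper leaves the room which [locG_commg] requires. *)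
Definition filled W : Prop := forall W' f g, clopen W' -> W' `<=` W ->
  (exists x, W x /\ ~ W' x) -> G f -> G g -> supp_in W' f -> supp_in W' g ->
  H [~ f, g].

Lemma filled_compress U W k f g : filled U -> H k -> clopen W ->
  im k W `<=` U -> (exists x, U x /\ ~ im k W x) -> G f -> G g ->
  supp_in W f -> supp_in W g -> H [~ f, g].
Proof.
move=> fU Hk cW kWU kWn Gf Gg sf sg; rewrite -(conjgK k [~ f, g]).
apply: subgroupJ => //; last exact: subgroupV.
rewrite conjRg; apply: (fU (im k W)) => //; try exact: supp_inJ.
- exact: im_clopen.
- by apply: subgroupJ => //; exact: HG.
- by apply: subgroupJ => //; exact: HG.
Qed.

Lemma filled_im U k : filled U -> H k -> filled (im k U).
Proof.
move=> fU Hk W f g cW WU [x [Ux nWx]] Gf Gg sf sg.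
apply: (@filled_compress U W k^-1) => //.
- exact: subgroupV.
- by move=> y /WU; rewrite /im /mkset invgK homeo_mulKx.
- exists (k^-1 x); split=> //.
  by rewrite imP.
Qed.

(** A commutator that agrees with a given g on [B]: let g carry [B] into [D], and let y carry [D]
    off the support of g. Then [g^-1, y^-1] is g followed by y g^-1 y^-1, and the latter fixes [D]
    pointwise. *)
Lemma filled_move U B D : filled U -> clopen U -> clopen B -> clopen D ->
  B `<=` U -> D `<=` U -> D !=set0 -> (exists u, [/\ U u, ~ B u & ~ D u]) ->
  exists k, [/\ H k, supp_in U k & forall x, B x -> D (k x)].
Proof.
move=> fU cU cB cD BU DU D0 [u [Uu nBu nDu]].
have [B0|B0] := pselect (B !=set0); last first.
  exists 1; split; [exact: subgroup1|by []|by move=> x Bx; case: B0; exists x].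
have cBD : clopen (B `|` D) by exact: clopenU.
(* [N] takes the image of [D] under y, while v keeps the support proper in [U]. The part [M] of [N]
   is lent to g, so that [B] and [D] are proper in the set where g acts. *)
have cN : clopen (U `\` (B `|` D)) by exact: clopenD.
have [|N [cN1 NU N0 [v [[Uv nBDv] nNv]]]] := clopen_split cN.
  by exists u; split=> // -[].
have [M [cM MN [z Mz] [w [Nw nMw]]]] := clopen_split cN1 N0.
have cA : clopen (B `|` D `|` N) by exact: clopenU.
have cA1 : clopen (B `|` D `|` M) by exact: clopenU.
have nBD y : N y -> ~ (B `|` D) y by move=> /NU[].
have [||||||||| g [Gg gB sg]] := @vigorousP G Gvig (B `|` D `|` M) B D => //.
- by move=> y By; left; left.
- by move=> y By; left; right.
- by exists z; split; [right|move=> Bz; apply: (nBD z); [exact: MN|left]].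
- by exists z; split; [right|move=> Bz; apply: (nBD z); [exact: MN|right]].
have [||||||||| y [Gy yD sy]] :=
  @vigorousP G Gvig (B `|` D `|` N) D (N `\` M) => //.
- exact: clopenD.
- by move=> y Dy; left; right.
- by move=> y [Ny _]; right.
- by exists w.
- exists w; split; [by right|move=> Dw; apply: (nBD w) => //; by right].
- by exists z; split=> [|[]//]; right; exact: MN.
have MNs : B `|` D `|` M `<=` B `|` D `|` N by apply: setUS.
exists [~ g^-1, y^-1]; split.
- apply: (fU (B `|` D `|` N)) => //.
  + move=> p [[/BU|/DU]|/NU[]] //.
  + exists v; split=> // -[|] //.
  + exact: subgroupV.
  + exact: subgroupV.
  + by apply: supp_inV; apply: supp_inW sg.
  + exact: supp_inV.
- apply: (@supp_inW (B `|` D `|` N)); first by move=> p [[/BU|/DU]|/NU[]].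
  by apply: supp_inR; apply: supp_inV => //; apply: supp_inW sg.
- move=> x Bx; rewrite commgEl conjgE !invgK !homeo_mulE.
  have Dgx := gB _ Bx; have [Ny nMy] := yD _ Dgx.
  rewrite (supp_inV sg) ?homeo_mulKx// => -[|//].
  exact: nBD.
Qed.

(** The point c left free in [V] gives room to compress the part of [W] in [V] into a small part of
    [U] and [V]; the image of [W] then lies in [U] and misses e. *)
Lemma filledU_half U V W c f g : filled U -> filled V -> clopen U -> clopen V ->
  U `&` V !=set0 -> clopen W -> W `<=` U `|` V -> V c -> ~ W c ->
  G f -> G g -> supp_in W f -> supp_in W g -> H [~ f, g].
Proof.
move=> fU fV cU cV UV0 cW WUV Vc nWc Gf Gg sf sg.
have cUV : clopen (U `&` V) by exact: clopenI.
have [d [[Ud Vd] dc]] := clopen_other_point c cUV UV0.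
have [e [[Ue Ve] ed]] := clopen_other_point d cUV UV0.
have [D [cD Dd Dc De _]] := cantor_separation3 dc (nesym ed) dc.
have cDUV : clopen (D `&` (U `&` V)) by exact: clopenI.
have cWV : clopen (W `&` V) by exact: clopenI.
have [||||k [Hk sk kW]] := @filled_move V (W `&` V) (D `&` (U `&` V)) fV cV cWV cDUV.
- by move=> ? [].
- by move=> ? [_ []].
- by exists d.
- by exists c; split=> // -[].
apply: (@filled_compress U W k) => //.
- move=> y Wy; rewrite -(homeo_mulVKx k y).
  have [Vy|nVy] := pselect (V (k^-1 y)).
    by have [_ []] := kW _ (conj Wy Vy).
  by rewrite sk//; case: (WUV _ Wy).
- exists e; split=> // Wke.
  have [Vy|nVy] := pselect (V (k^-1 e)).
    by have [+ _] := kW _ (conj Wke Vy); rewrite homeo_mulVKx.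
  by apply: nVy; apply: supp_in_stable Ve; exact: supp_inV.
Qed.

Lemma filledU U V : filled U -> filled V -> clopen U -> clopen V ->
  U `&` V !=set0 -> filled (U `|` V).
Proof.
move=> fU fV cU cV UV0 W f g cW WUV [c [[Uc|Vc] nWc]] Gf Gg sf sg.
  apply: (@filledU_half V U W c) => //; first by rewrite setIC.
  by rewrite setUC.
exact: (@filledU_half U V W c).
Qed.

Lemma filled_all : filled setT -> G `<=` H.
Proof.
move=> fT; apply: (local_commutators_gen Gsub Gsimple Gvig Hsub).
move=> _ [f [g [W [Gf Gg cW [[x nWx] sf sg ->]]]]].
by apply: (fT W) => //; exists x.
Qed.

(** Filled sets containing [Q] overlap, so finite unions of them are filled; [K] is the union of
    them all. It is invariant under [a] because [a] keeps a point of [Q] in [Q]. For [b] there is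
    only a fixed point in the image of [Q] under [a], so each set is first enlarged by that
    image. *)
Lemma filled_exhaust Q a b : filled Q -> clopen Q -> H a -> H b ->
  (exists x, Q x /\ Q (a x)) -> (exists x, Q x /\ b (a x) = a x) ->
  (forall K : set CS, Q `<=` K ->
     (forall c x, c \in [:: a; a^-1; b; b^-1] -> K x -> K (c x)) ->
     K = setT) ->
  G `<=` H.
Proof.
move=> fQ cQ Ha Hb [q [Qq Qaq]] [r [Qr br]] all_K.
pose U0 W := [/\ clopen W, filled W & Q `<=` W].
have U0U W W' : U0 W -> clopen W' -> filled W' -> W `&` W' !=set0 -> U0 (W `|` W').
  move=> [cW fW QW] cW' fW' WW'; split; [exact: clopenU|exact: filledU|].
  by move=> y /QW; left.
have U0im c W W1 : H c -> U0 W -> U0 W1 -> (exists2 x, W x & W1 (c x)) ->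
    U0 (W1 `|` im c W).
  move=> Hc [cW fW QW] U1 [x Wx W1cx]; apply: U0U => //.
  - exact: im_clopen.
  - exact: filled_im.
  - by exists (c x); split=> //; rewrite imP.
have UQ : U0 Q by split.
pose K : set CS := [set x | exists2 W, U0 W & W x].
have stepa c x : (c = a \/ c = a^-1) -> K x -> K (c x).
  move=> ca [W UW Wx]; exists (Q `|` im c W); last by right; rewrite imP.
  have QW : Q `<=` W by case: UW.
  apply: U0im => //; first by case: ca => ->//; exact: subgroupV.
  case: ca => ->; [by exists q => //; exact: QW|].
  by exists (a q); [exact: QW|rewrite homeo_mulKx].
have UR : U0 (Q `|` im a Q) by apply: U0im => //; exists q.
have Rr : (Q `|` im a Q) (a r) by right; rewrite imP.
have stepb c x : (c = b \/ c = b^-1) -> K x -> K (c x).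
  move=> cb [W UW Wx].
  have UWR : U0 (W `|` (Q `|` im a Q)).
    case: UR => cR fR QR; apply: U0U => //; exists q; split; last by left.
    by case: UW => _ _; apply.
  exists ((Q `|` im a Q) `|` im c (W `|` (Q `|` im a Q))); last first.
    by right; rewrite imP; left.
  apply: U0im => //; first by case: cb => ->//; exact: subgroupV.
  exists (a r); first by right.
  case: cb => ->; first by rewrite br.
  by rewrite -{1}br homeo_mulKx.
have KT : K = setT.
  apply: all_K => [x Qx|c x]; first by exists Q.
  rewrite !inE => /or4P[] /eqP ->.
  - by apply: stepa; left.
  - by apply: stepa; right.
  - by apply: stepb; left.
  - by apply: stepb; right.
have /choice[W HW] x : exists W, U0 W /\ W x.
  by have : K x by [rewrite KT]; case=> W UW Wx; exists W.
have [||s sW] := @cantor_finite_cover W.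
- by move=> x; case: (HW x) => -[] [].
- by move=> x; case: (HW x).
have US : U0 (Q `|` [set x | exists2 y, y \in s & W y x]).
  elim: {sW}s => [|y s [IHc IHf IHQ]].
    rewrite (_ : _ `|` _ = Q)// eqEsubset; split=> [x [//|[]//]|x]; by left.
  have [cW fW QW] := (HW y).1.
  rewrite (_ : _ `|` _ = (Q `|` [set x | exists2 z, z \in s & W z x]) `|` W y).
    apply: U0U => //; exists q; split; [by left|exact: QW].
  rewrite eqEsubset; split=> x.
    move=> [Qx|[z]]; first by left; left.
    rewrite inE => /orP[/eqP->|zs] Wz; [by right|left; right; by exists z].
  move=> [[Qx|[z zs Wz]]|Wyx]; first by left.
    by right; exists z => //; rewrite inE zs orbT.
  by right; exists y => //; rewrite inE eqxx.
apply: filled_all; case: US => _ + _; rewrite (_ : _ `|` _ = setT)//.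
by rewrite eqEsubset; split=> // x _; right; exact: sW.
Qed.

End Filling.

(** * Permutations of cells *)

Lemma locally_homeo_continuous (f : CS -> CS) :
  (forall x, exists (g : homeo CS) U,
     [/\ clopen U, U x & forall y, U y -> f y = g y]) -> continuous f.
Proof.
move=> lf x A; have [g [U [[oU _] Ux fg]]] := lf x.
have Un : nbhs x U by apply: open_nbhs_nbhs; split.
rewrite fg// => Agx; have Ag : nbhs x (g @^-1` A) by exact: (homeo_continuous Agx).
have sub : U `&` (g @^-1` A) `<=` f @^-1` A.
  by move=> y [Uy]; rewrite /preimage /mkset fg.
exact: (filterS sub (filterI Un Ag)).
Qed.

Section Cells.
Variable G : set (homeo CS).
Hypothesis Gsub : is_subgroup G.
Hypothesis Gsimple : simple_group G.
Hypothesis Gvig : vigorous G.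
Variables (J : eqType) (F : seq J) (E : set CS) (theta : J -> CS -> CS).

(** [cell_inj] says at once that each embedding is injective on [E] and that distinct cells are
    disjoint. *)
Record cell_family : Prop := CellFamily {
  cell_base : clopen E;
  cell_loc : forall j q, j \in F -> E q -> exists g U, [/\ G g, clopen U, U q &
    forall q', U q' -> E q' -> theta j q' = g q'];
  cell_inj : forall j j' q q', j \in F -> j' \in F -> E q -> E q' ->
    theta j q = theta j' q' -> j = j' /\ q = q' }.

Hypothesis cells : cell_family.

Definition cell j : set CS := [set x | exists2 q, E q & theta j q = x].

Definition all_cells : set CS := [set x | exists2 j, j \in F & cell j x].

Lemma cell_clopen j : j \in F -> clopen (cell j).
Proof.
move=> Fj; suff /(_ E) : forall U, clopen U -> U `<=` E ->
  clopen [set x | exists2 q, U q & theta j q = x].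
  by apply => //; exact: cell_base.
apply: clopen_ind => [x|U1 U2 cU1 cU2 _ IH1 IH2 UE]; last first.
  rewrite (_ : mkset _ = [set x | exists2 q, U1 q & theta j q = x] `|`
                         [set x | exists2 q, U2 q & theta j q = x]).
    by apply: clopenU; [apply: IH1|apply: IH2] => y Uy; apply: UE; [left|right].
  rewrite eqEsubset; split=> [y [q [Uq|Uq] <-]|y [[q Uq <-]|[q Uq <-]]].
  - by left; exists q.
  - by right; exists q.
  - by exists q => //; left.
  - by exists q => //; right.
have [Ex|nEx] := pselect (E x); last first.
  exists (~` E); split=> //; first exact/clopen_setC/cell_base.
  move=> U cU UE UE'; rewrite (_ : mkset _ = set0); first exact: clopen0.
  by rewrite -subset0 => y [q Uq _]; case: (UE q Uq); exact: UE'.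
have [g [V [Gg cV Vx Vg]]] := cell_loc cells Fj Ex.
exists V; split=> // U cU UV UE.
rewrite (_ : mkset _ = im g U); first exact: im_clopen.
rewrite eqEsubset; split=> y.
  by move=> [q Uq <-]; rewrite Vg ?imP//; [exact: UV|exact: UE].
move=> Uy; exists (g^-1 y) => //; rewrite Vg ?homeo_mulVKx//.
- exact: UV.
- exact: UE.
Qed.

Lemma all_cells_clopen : clopen all_cells.
Proof.
suff H (s : seq J) : {subset s <= F} -> clopen [set x | exists2 j, j \in s & cell j x].
  exact: H.
elim: s => [_|j s IHs sF].
  rewrite (_ : mkset _ = set0); first exact: clopen0.
  by rewrite -subset0 => x [].
rewrite (_ : mkset _ = cell j `|` [set x | exists2 i, i \in s & cell i x]).
  apply: clopenU; first by apply: cell_clopen; apply: sF; rewrite inE eqxx.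
  by apply: IHs => i si; apply: sF; rewrite inE si orbT.
rewrite eqEsubset; split=> x.
  move=> [i]; rewrite inE => /orP[/eqP->|si] xi; [by left|right; by exists i].
by move=> [xj|[i si xi]]; [exists j|exists i] => //; rewrite inE ?eqxx ?si ?orbT.
Qed.

Implicit Types (f : homeo CS) (s : J -> J) (g : J -> homeo CS).

(** The analogue of a monomial matrix: a permutation of the cells with a homeomorphism as entry at
    each cell. *)
Definition monomial f s g : Prop :=
  (forall j q, j \in F -> E q -> f (theta j q) = theta (s j) (g j q)) /\
  supp_in all_cells f.

Definition cell_perm s s' : Prop := forall j, j \in F ->
  [/\ s j \in F, s' j \in F, s' (s j) = j & s (s' j) = j].

Definition cell_twist g : Prop := forall j, j \in F ->
  G (g j) /\ forall q, E q -> E (g j q) /\ E ((g j)^-1 q).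

Lemma in_all_cells j q : j \in F -> E q -> all_cells (theta j q).
Proof. by move=> Fj Eq; exists j => //; exists q. Qed.

Lemma monomial_mul f1 s1 g1 f2 s2 g2 s1' :
  cell_perm s1 s1' -> cell_twist g1 ->
  monomial f1 s1 g1 -> monomial f2 s2 g2 ->
  monomial (f1 * f2) (s2 \o s1) (fun j => g1 j * g2 (s1 j)).
Proof.
move=> ps1 tg1 [f1E sf1] [f2E sf2]; split; last exact: supp_inM.
move=> j q Fj Eq; have [s1F _ _ _] := ps1 j Fj; have [_ gE] := tg1 j Fj.
by rewrite homeo_mulE f1E// f2E//; case: (gE q Eq).
Qed.

Lemma monomial_eq f1 s1 g1 f2 s2 g2 : monomial f1 s1 g1 -> monomial f2 s2 g2 ->
  (forall j, j \in F -> s1 j = s2 j /\ forall q, E q -> g1 j q = g2 j q) ->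
  f1 = f2.
Proof.
move=> [f1E sf1] [f2E sf2] e12; apply: homeoP => x.
have [[j Fj [q Eq <-]]|nx] := pselect (all_cells x); last by rewrite sf1// sf2.
by rewrite f1E// f2E//; case: (e12 j Fj) => -> /(_ q Eq)->.
Qed.

Definition cellmap (phi : J -> CS -> CS) (x : CS) : CS :=
  if pselect (exists jq : J * CS, [/\ jq.1 \in F, E jq.2 & theta jq.1 jq.2 = x])
    is left ex then let jq := sval (cid ex) in phi jq.1 jq.2 else x.

Lemma cellmapE phi j q : j \in F -> E q -> cellmap phi (theta j q) = phi j q.
Proof.
move=> Fj Eq; rewrite /cellmap; case: pselect => [ex|[]]; last by exists (j, q).
by case: (cid ex) => -[j' q'] /= [Fj' Eq' /(cell_inj cells Fj' Fj Eq' Eq)[-> ->]].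
Qed.

Lemma cellmap_out phi x : ~ all_cells x -> cellmap phi x = x.
Proof.
move=> nx; rewrite /cellmap; case: pselect => // -[[j q] /= [Fj Eq xE]].
by case: nx; exists j => //; exists q.
Qed.

Lemma monomial_exists s s' g : cell_perm s s' -> cell_twist g ->
  exists f, locG G f /\ monomial f s g.
Proof.
move=> ps tg.
pose F1 := cellmap (fun j q => theta (s j) (g j q)).
pose F2 := cellmap (fun j q => theta (s' j) ((g (s' j))^-1 q)).
have K1 : cancel F1 F2.
  move=> x; have [[j Fj [q Eq <-]]|nx] := pselect (all_cells x); last first.
    by rewrite /F1 /F2 !cellmap_out.
  have [sF s'F s's ss'] := ps j Fj; have [Gg gE] := tg j Fj; have [g1 g2] := gE q Eq.
  by rewrite /F1 /F2 !cellmapE// s's homeo_mulKx.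
have K2 : cancel F2 F1.
  move=> x; have [[j Fj [q Eq <-]]|nx] := pselect (all_cells x); last first.
    by rewrite /F1 /F2 !cellmap_out.
  have [sF s'F s's ss'] := ps j Fj; have [Gg gE] := tg _ s'F; have [g1 g2] := gE q Eq.
  by rewrite /F1 /F2 !cellmapE// ss' homeo_mulVKx.
have L1 x : exists h U, [/\ G h, clopen U, U x & forall y, U y -> F1 y = h y].
  have [[j Fj [q Eq <-]]|nx] := pselect (all_cells x); last first.
    exists 1, (~` all_cells); split; [exact: subgroup1| |by []|].
      exact/clopen_setC/all_cells_clopen.
    by move=> y ny; rewrite /F1 cellmap_out.
  have [sF s'F s's ss'] := ps j Fj; have [Gg gE] := tg j Fj; have [g1 g2] := gE q Eq.
  have [h1 [U1 [Gh1 cU1 U1q h1U]]] := cell_loc cells Fj Eq.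
  have [h2 [U2 [Gh2 cU2 U2q h2U]]] := cell_loc cells sF g1.
  (* The local element of [G]: back through [theta j], the twist, out through [theta (s j)]. *)
  exists (h1^-1 * g j * h2), (im h1 (U1 `&` E `&` [set q' | U2 (g j q')])).
  split.
  - by do !apply: subgroupM => //; exact: subgroupV.
  - apply: im_clopen; apply: clopenI; last exact: pre_clopen.
    by apply: clopenI => //; exact: cell_base.
  - by rewrite h1U// imP.
  - move=> y [[U1y Ey] U2y]; rewrite !homeo_mulE.
    have [gEy _] := gE _ Ey.
    by rewrite -{1}(homeo_mulVKx h1 y) -h1U// /F1 cellmapE// h2U.
have L2 x : exists h U, [/\ G h, clopen U, U x & forall y, U y -> F2 y = h y].
  have [h [U [Gh cU Ux hU]]] := L1 (F2 x).
  exists h^-1, (im h U); split; [exact: subgroupV|exact: im_clopen| |].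
    by rewrite -{1}(K2 x) hU// imP.
  by move=> y Uy; rewrite -{1}(homeo_mulVKx h y) -hU// K1.
have C1 : continuous F1.
  apply: locally_homeo_continuous => x.
  by have [h [U [Gh cU Ux hU]]] := L1 x; exists h, U.
have C2 : continuous F2.
  apply: locally_homeo_continuous => x.
  by have [h [U [Gh cU Ux hU]]] := L2 x; exists h, U.
exists (Homeo K1 K2 C1 C2); split=> //; split=> [j q Fj Eq|x nx] /=.
  by rewrite /F1 cellmapE.
by rewrite /F1 cellmap_out.
Qed.

Lemma cell_twist1 : cell_twist (fun=> 1).
Proof. by move=> j Fj; split=> //; exact: subgroup1. Qed.

End Cells.

(** * Membership in [G] of permutations and twists of cells *)

Section Membership.
Variable G : set (homeo CS).
Hypothesis Gsub : is_subgroup G.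
Hypothesis Gsimple : simple_group G.
Hypothesis Gvig : vigorous G.

Lemma commg_unique (gT : groupType) (u v f : gT) : u * v = v * u * f -> f = [~ u, v].
Proof. by move=> uv; rewrite commgEl conjgE uv -!mulgA !mulKg. Qed.

(* A permutation of the cells may be odd, but pairing it with its inverse on a
   second copy of the cells gives a commutator. *)
Lemma doubled_in_G (V : eqType) (FV : seq V) E theta (s s' : V -> V) f :
  let F := [seq (e, v) | e <- [:: false; true], v <- FV] in
  cell_family G F E theta ->
  (exists x, ~ all_cells F E theta x) ->
  (forall v, v \in FV -> [/\ s v \in FV, s' v \in FV, s' (s v) = v & s (s' v) = v]) ->
  monomial F E theta f
    (fun j : bool * V => (j.1, if j.1 then s' j.2 else s j.2)) (fun=> 1) ->
  G f.
Proof.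
move=> F cells [x nx] ss' mf.
have inF e v : ((e, v) \in F) = (v \in FV).
  apply/allpairsP/idP => [[[e' v'] /= [_ + [_ ->]]]//|vF].
  by exists (e, v); split=> //; rewrite !inE; case: e.
have tw : cell_twist G F E (fun=> 1) by exact: cell_twist1.
pose su (j : bool * V) := if j.1 then j else (false, s' j.2).
pose su' (j : bool * V) := if j.1 then j else (false, s j.2).
pose sv (j : bool * V) := (~~ j.1, j.2).
have pu : cell_perm F su su'.
  case=> [[] v]; rewrite inF => vF; rewrite /su /su' /= ?inF//.
  by have [? ? e1 e2] := ss' v vF; rewrite ?inF ?e1 ?e2.
have pv : cell_perm F sv sv.
  by case=> [e v]; rewrite inF => vF; rewrite /sv /= negbK !inF.
have [u [lu mu]] := monomial_exists Gsub cells pu tw.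
have [v [lv mv]] := monomial_exists Gsub cells pv tw.
have uv := monomial_mul pu tw mu mv.
have vu := monomial_mul pv tw mv mu.
have pvu : cell_perm F (su \o sv) (sv \o su').
  by move=> j Fj; have [? ? e1 e2] := pv j Fj;
    have [? ? e3 e4] := pu (sv j) ltac:(assumption);
    have [? ? e5 e6] := pu j Fj;
    have [? ? e7 e8] := pv (su' j) ltac:(assumption);
    split=> //=; rewrite ?e3 ?e8 ?e1 ?e6.
have tw2 : cell_twist G F E (fun=> 1 * 1).
  move=> j Fj; have [G1 E1] := tw j Fj; split=> [|q Eq]; rewrite mul1g //; exact: E1.
have vuf := monomial_mul pvu tw2 vu mf.
(* Here [u] acts by [s'] on the first copy alone and [v] exchanges the copies; u v and v u f carry
   every cell to the same place. *)
have -> : f = [~ u, v].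
  apply: commg_unique; apply: (monomial_eq uv vuf).
  case=> [[] w]; rewrite inF => wF; split=> //; rewrite /sv /su /=.
  by have [_ _ _ ->] := ss' w wF.
apply: (locG_commg Gsub Gsimple Gvig lu lv (all_cells_clopen cells)).
- by case: mu.
- by case: mv.
- by exists x.
Qed.

Section Twist.
Variables (J : eqType) (F : seq J) (theta : J -> CS -> CS).
Hypothesis cells : cell_family G F setT theta.
Hypothesis outside : exists x, ~ all_cells F setT theta x.
Let tw (g : J -> homeo CS) : (forall j, j \in F -> G (g j)) -> cell_twist G F setT g.
Proof. by move=> Gg j Fj; split=> //; exact: Gg. Qed.

(** Copying onto one cell is a homomorphism from [G] to the homeomorphisms locally in [G]. The
    elements whose copy lies in [G] form a subgroup; it contains commutators, since the copy of a
    commutator is a commutator of copies, and simplicity does the rest. *)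
Lemma cell_copy_in_G j0 g f : j0 \in F -> G g ->
  monomial F setT theta f id (fun j => if j == j0 then g else 1) -> G f.
Proof.
move=> Fj0 Gg; pose at0 (k : homeo CS) j := if j == j0 then k else 1.
have Gat k : G k -> forall j, j \in F -> G (at0 k j).
  by move=> Gk j _; rewrite /at0; case: ifP => // _; exact: subgroup1.
have pid : cell_perm F id id by [].
pose K := [set k | G k /\ forall f, monomial F setT theta f id (at0 k) -> G f].
suff /(_ g Gg) [_] : G `<=` K by apply.
have Kex k : G k -> exists f, locG G f /\ monomial F setT theta f id (at0 k).
  by move=> Gk; apply: (monomial_exists Gsub cells pid); apply/tw/Gat.
have Kmul k1 k2 f1 f2 : G k1 -> G k2 -> monomial F setT theta f1 id (at0 k1) ->
   monomial F setT theta f2 id (at0 k2) ->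
   monomial F setT theta (f1 * f2) id (at0 (k1 * k2)).
  move=> Gk1 Gk2 m1 m2; have [m m'] := monomial_mul pid (tw (Gat _ Gk1)) m1 m2.
  split=> // j q Fj Eq; rewrite m//= /at0; by case: ifP => //; rewrite mul1g.
have Keq k1 k2 f1 f2 : k1 = k2 -> monomial F setT theta f1 id (at0 k1) ->
   monomial F setT theta f2 id (at0 k2) -> f1 = f2.
  by move=> <- m1 m2; apply: (monomial_eq m1 m2).
apply: (local_commutators_gen Gsub Gsimple Gvig).
- apply/is_subgroupP; split.
  + split=> [|h mh]; first exact: subgroup1.
    suff -> : h = 1 by exact: subgroup1.
    apply: (Keq 1 1 h 1) => //; split=> // j q Fj _; rewrite /at0.
    by case: ifP.
  + move=> k1 k2 [Gk1 K1] [Gk2 K2]; split=> [|h mh]; first exact: subgroupM.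
    have [f1 [_ m1]] := Kex _ Gk1; have [f2 [_ m2]] := Kex _ Gk2.
    rewrite (Keq _ _ _ _ erefl mh (Kmul _ _ _ _ Gk1 Gk2 m1 m2)).
    by apply: subgroupM => //; [exact: K1|exact: K2].
  + move=> k [Gk Kk]; split=> [|h mh]; first exact: subgroupV.
    have [f1 [_ m1]] := Kex _ Gk.
    suff -> : h = f1^-1 by apply: subgroupV => //; exact: Kk.
    have m := Kmul _ _ _ _ Gk (subgroupV Gsub Gk) m1 mh.
    have e : f1 * h = 1.
      apply: (Keq _ 1 _ _ _ m); first by rewrite mulgV.
      by split=> // j q Fj _; rewrite /at0; case: ifP.
    by rewrite -[h](mulKg f1) e mulg1.
- move=> _ [k1 [k2 [W [Gk1 Gk2 _ [_ _ _ ->]]]]].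
  split=> [|h mh]; first exact: subgroupR.
  have [f1 [l1 m1]] := Kex _ Gk1; have [f2 [l2 m2]] := Kex _ Gk2.
  suff -> : h = [~ f1, f2].
    apply: (locG_commg Gsub Gsimple Gvig l1 l2 (all_cells_clopen cells)) => //.
    + by case: m1.
    + by case: m2.
  apply: commg_unique.
  have m12 := Kmul _ _ _ _ Gk1 Gk2 m1 m2.
  have m21 := Kmul _ _ _ _ Gk2 Gk1 m2 m1.
  have m := Kmul _ _ _ _ (subgroupM Gsub Gk2 Gk1) (subgroupR Gsub Gk1 Gk2) m21 mh.
  exact: (Keq _ _ _ _ (commgC k1 k2) m12 m).
Qed.

Lemma twist_in_G g f : (forall j, j \in F -> G (g j)) ->
  monomial F setT theta f id g -> G f.
Proof.
move=> Gg; pose on (s : seq J) j := if j \in s then g j else 1.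
have Gon s j : j \in F -> G (on s j).
  by rewrite /on; case: ifP => // _ Fj; [exact: Gg|exact: subgroup1].
have pid : cell_perm F id id by [].
suff H (s : seq J) : {subset s <= F} -> forall f, monomial F setT theta f id (on s) -> G f.
  move=> mf; apply: (H F) => //.
  by case: mf => mf sf; split=> // j q Fj Eq; rewrite mf// /on Fj.
elim: s => [_ h mh|j0 s IHs sF h mh].
  suff -> : h = 1 by exact: subgroup1.
  by apply: (monomial_eq mh (s2 := id) (g2 := fun=> 1)) => //; split.
have Fj0 : j0 \in F by apply: sF; rewrite inE eqxx.
have {}IHs := IHs (fun j js => sF j ltac:(by rewrite inE js orbT)).
have [js|njs] := boolP (j0 \in s).
  apply: IHs; case: mh => mh sh; split=> // j q Fj Eq.
  by rewrite mh// /on inE; case: eqP => [->|//]; rewrite js.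
pose at0 j := if j == j0 then g j0 else 1.
have Gat j : j \in F -> G (at0 j).
  by rewrite /at0; case: ifP => // _ _; [exact: Gg|exact: subgroup1].
have [f1 [_ m1]] := monomial_exists Gsub cells pid (tw Gat).
have [f2 [_ m2]] := monomial_exists Gsub cells pid (tw (Gon s)).
have m := monomial_mul pid (tw Gat) m1 m2.
have -> : h = f1 * f2.
  apply: (monomial_eq mh m) => j Fj; split=> // q _; rewrite /on /at0 inE /=.
  by case: eqP => [->|_]; rewrite ?(negbTE njs) /= ?mulg1 ?mul1g.
apply: subgroupM => //; last exact: IHs.
exact: (cell_copy_in_G Fj0 (Gg _ Fj0) m1).
Qed.

End Twist.

Lemma monomial_in_G (V : eqType) (FV : seq V) theta (s s' : V -> V) g f :
  let F := [seq (e, v) | e <- [:: false; true], v <- FV] in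
  cell_family G F setT theta ->
  (exists x, ~ all_cells F setT theta x) ->
  (forall v, v \in FV -> [/\ s v \in FV, s' v \in FV, s' (s v) = v & s (s' v) = v]) ->
  (forall j, j \in F -> G (g j)) ->
  monomial F setT theta f
    (fun j : bool * V => (j.1, if j.1 then s' j.2 else s j.2)) g ->
  G f.
Proof.
move=> F cells out ss' Gg mf.
have inF e v : ((e, v) \in F) = (v \in FV).
  apply/allpairsP/idP => [[[e' v'] /= [_ + [_ ->]]]//|vF].
  by exists (e, v); split=> //; rewrite !inE; case: e.
pose sd (j : bool * V) := (j.1, if j.1 then s' j.2 else s j.2).
pose sd' (j : bool * V) := (j.1, if j.1 then s j.2 else s' j.2).
have pd : cell_perm F sd sd'.
  case=> [[] v]; rewrite inF => vF; rewrite /sd /sd' /= !inF;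
  by have [? ? -> ->] := ss' v vF.
have tw1 : cell_twist G F setT (fun=> 1) by exact: cell_twist1.
have [f1 [_ m1]] := monomial_exists Gsub cells pd tw1.
have Gg' j : j \in F -> G (g (sd' j)).
  by move=> Fj; apply: Gg; case: (pd j Fj).
(* The twists are applied after the permutation, hence on the target cells, which is why they are
   indexed through [sd']. *)
have [||f2 [_ m2]] := @monomial_exists G Gsub _ _ _ _ cells id id (g \o sd').
- by [].
- by move=> j Fj; split=> //; exact: Gg'.
have m := monomial_mul pd tw1 m1 m2.
have -> : f = f1 * f2.
  apply: (monomial_eq mf m) => j Fj; split=> // q _ /=.
  by have [_ _ -> _] := pd j Fj.
apply: subgroupM => //; first exact: (doubled_in_G cells out ss' m1).
exact: (twist_in_G cells out Gg' m2).
Qed.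

End Membership.

(** * Existence of cells, of the link rotation and of torsion generators *)

Lemma clopen_family (A : set CS) : clopen A -> A !=set0 ->
  exists P : nat -> set CS, [/\ forall i, clopen (P i), forall i, P i !=set0,
    forall i, P i `<=` A & forall i j x, P i x -> P j x -> i = j].
Proof.
move=> cA A0.
have /choice[D HD] (B : set CS) : exists U, clopen B -> B !=set0 ->
    [/\ clopen U, U `<=` B, U !=set0 & B `\` U !=set0].
  have [[cB B0]|nB] := pselect (clopen B /\ B !=set0); last first.
    by exists set0 => cB B0; case: nB.
  by have [U HU] := clopen_split cB B0; exists U.
pose rest k := iter k (fun B => B `\` D B) A.
have Hrest k : clopen (rest k) /\ rest k !=set0.
  elim: k => [//|k [cR R0]]; have [cD _ _ R'] := HD _ cR R0.
  by split; [exact: clopenD|exact: R'].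
have restS j k : j <= k -> rest k `<=` rest j.
  move=> jk; rewrite -(subnK jk); elim: (k - j)%N => [//|i IHi].
  by move=> x [/IHi].
have DP k : [/\ clopen (D (rest k)), D (rest k) `<=` rest k & D (rest k) !=set0].
  by have [cR R0] := Hrest k; have [] := HD _ cR R0.
have Plt i j x : i < j -> D (rest i) x -> ~ D (rest j) x.
  by move=> ij Dx; have [_ sD _] := DP j; move=> /sD /(restS _ _ ij)[].
exists (fun k => D (rest k)); split=> i; [by have [] := DP i|by have [] := DP i| |].
  by have [_ sD _] := DP i; move=> x /sD /(restS 0 i isT).
move=> j x Di Dj; have [ij|ij|//] := ltngtP i j.
  by have := Plt _ _ _ ij Di.
by have := Plt _ _ _ ij Dj.
Qed.

Lemma iter_homeo_fixed (f : homeo CS) m j x :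
  (f ^+ m) x = x -> (f ^+ m) ((f ^+ j) x) = (f ^+ j) x.
Proof. by move=> fx; rewrite -homeo_mulE -expgnDr addnC expgnDr homeo_mulE fx. Qed.

Section Data.
Variable G : set (homeo CS).
Hypothesis Gsub : is_subgroup G.
Hypothesis Gsimple : simple_group G.
Hypothesis Gvig : vigorous G.

Lemma vigorous_push (B P : set CS) : clopen B -> clopen P -> P !=set0 ->
  (exists x, ~ B x) -> (exists x, ~ P x) ->
  exists g, G g /\ forall x, B x -> P (g x).
Proof.
move=> cB cP P0 [b nBb] [p nPp].
have [B0|B0] := pselect (B !=set0); last first.
  by exists 1; split; [exact: subgroup1|move=> x Bx; case: B0; exists x].
have [||||||||| g [Gg gB _]] := @vigorousP G Gvig setT B P => //.
- exact: clopenT.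
- by exists b.
- by exists p.
- by exists g.
Qed.

(** A bijection cannot carry the whole space into a proper part, so each cell is made of two pieces:
    [A] goes to an odd member of the family [P] and its complement to the next even one. [P 0] is
    left for the rest. *)
Lemma full_cells (J : countType) : exists theta : J -> CS -> CS,
  (forall F, cell_family G F setT theta) /\ exists x, forall j q, theta j q <> x.
Proof.
have CS0 : [set: CS] !=set0 by exists point.
have [P [cP P0 _ PI]] := clopen_family clopenT CS0.
have [A [cA _ A0 [a [_ nAa]]]] := clopen_split clopenT CS0.
have notP i : exists x, ~ P i x.
  have [x Px] := P0 i.+1; exists x => Pix.
  by have := PI _ _ _ Px Pix; lia.
have /choice[g Hg] i : exists g, G g /\ forall x, A x -> P i (g x).
  by apply: vigorous_push => //; exists a.
have /choice[h Hh] i : exists g, G g /\ forall x, (~` A) x -> P i (g x).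
  apply: vigorous_push => //; first exact: clopen_setC.
  by have [x Ax] := A0; exists x.
pose k (j : J) := (choice.pickle j).*2.+1.
pose theta j q := if pselect (A q) then g (k j) q else h (k j).+1 q.
have thP j q : P (k j) (theta j q) /\ A q \/ P (k j).+1 (theta j q) /\ ~ A q.
  rewrite /theta; case: pselect => Aq; [left|right]; split=> //.
    by case: (Hg (k j)) => _; apply.
  by case: (Hh (k j).+1) => _; apply.
exists theta; split=> [F|]; last first.
  have [x Px] := P0 0; exists x => j q e.
  by have [[]|[]] := thP j q; rewrite e => /(PI _ _ _ Px).
split=> [|j q _ _|j j' q q' _ _ _ _ e]; first exact: clopenT.
  have [Aq|nAq] := pselect (A q).
    exists (g (k j)), A; split=> //; first by case: (Hg (k j)).
    by move=> q' Aq' _; rewrite /theta; case: pselect.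
  exists (h (k j).+1), (~` A); split=> //; first by case: (Hh (k j).+1).
    exact: clopen_setC.
  by move=> q' Aq' _; rewrite /theta; case: pselect.
have jj : k j = k j' /\ (A q <-> A q').
  have [[P1 A1]|[P1 A1]] := thP j q; have [[P2 A2]|[P2 A2]] := thP j' q';
    rewrite e in P1; have kk := PI _ _ _ P1 P2.
  - by split=> //; split.
  - by move: kk; rewrite /k -!addnn; lia.
  - by move: kk; rewrite /k -!addnn; lia.
  - by split; [exact: succn_inj|split].
case: jj => kj AA.
have jE : j = j' by apply: (pcan_inj (@choice.pickleK J)); move: kj; rewrite /k -!addnn; lia.
split=> //; move: e; rewrite -jE /theta.
case: pselect => Aq; case: pselect => Aq2 /= e.
- exact: (homeo_inj e).
- by case: Aq2; apply/AA.
- by case: Aq; apply/AA.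
- exact: (homeo_inj e).
Qed.

Lemma sub_cells (J : countType) (j0 : J) (E D : set CS) : clopen E -> clopen D ->
  D !=set0 -> (forall x, D x -> ~ E x) -> exists theta : J -> CS -> CS,
  [/\ forall F, cell_family G F E theta, theta j0 = id,
    forall j q, j <> j0 -> E q -> D (theta j q) &
    exists2 x, D x & forall j q, E q -> theta j q <> x].
Proof.
move=> cE cD D0 DE; have [P [cP P0 PD PI]] := clopen_family cD D0.
have notP i : exists x, ~ P i x.
  have [x Px] := P0 i.+1; exists x => Pix.
  by have := PI _ _ _ Px Pix; lia.
have /choice[g Hg] i : exists g, G g /\ forall x, E x -> P i (g x).
  apply: vigorous_push => //; have [d Dd] := D0; exists d; exact: DE.
pose k (j : J) := (choice.pickle j).+1.
pose ga (j : J) : homeo CS := if pselect (j = j0) then 1 else g (k j).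
have gaG j : G (ga j).
  rewrite /ga; case: pselect => ? /=; first exact: subgroup1.
  by case: (Hg (k j)).
have gaP j q : j <> j0 -> E q -> P (k j) (ga j q).
  by move=> jj0 Eq; rewrite /ga; case: pselect => // ? /=; case: (Hg (k j)) => _; apply.
have ga0 : ga j0 = 1 by rewrite /ga; case: pselect.
exists (fun j => (ga j : CS -> CS)); split.
- move=> F; split=> // [j q Fj Eq|j j' q q' _ _ Eq Eq' e].
    by exists (ga j), setT; split=> //; exact: clopenT.
  have jj : j = j'.
    have [j_0|j_0] := pselect (j = j0); have [j_0'|j_0'] := pselect (j' = j0).
    + by rewrite j_0 j_0'.
    + case: (DE (ga j' q')); first by apply: (PD (k j')); exact: gaP.
      by rewrite -e j_0 ga0.
    + case: (DE (ga j q)); first by apply: (PD (k j)); exact: gaP.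
      by rewrite e j_0' ga0.
    + have := PI _ _ _ (gaP _ _ j_0 Eq); rewrite e => /(_ _ (gaP _ _ j_0' Eq')).
      by move=> [] kk; apply: (pcan_inj (@choice.pickleK J)).
  by split=> //; move: e; rewrite jj => /homeo_inj.
- by rewrite ga0.
- by move=> j q jj0 Eq; apply: (PD (k j)); exact: gaP.
- have [x Px] := P0 0; exists x; first exact: PD Px.
  move=> j q Eq e; have [j_0|j_0] := pselect (j = j0).
    by move: e; rewrite j_0 ga0 => e; apply: (DE x); [exact: PD Px|rewrite -e].
  by have := gaP _ _ j_0 Eq; rewrite e => /(PI _ _ _ Px).
Qed.

(** [E] and m-1 copies of it inside [D] are rotated forwards, and m further copies inside [D]
    backwards, which is the shape that [doubled_in_G] accepts. The backward cycle also supplies the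
    point that stays in [D]. *)
Lemma rotation_exists (E D : set CS) m : 2 <= m -> clopen E -> clopen D ->
  E !=set0 -> D !=set0 -> (forall x, D x -> ~ E x) ->
  exists r, [/\ G r, r ^+ m = 1, supp_in (E `|` D) r,
    forall q, E q -> exists2 x, D x & r x = q & exists2 x, D x & D (r x)].
Proof.
move=> m2 cE cD E0 D0 DE.
have [theta [cells th0 thD [z Dz thz]]] :=
  @sub_cells (bool * nat)%type (false, 0) E D cE cD D0 DE.
pose FV := iota 0 m.
pose F := [seq (e, v) | e <- [:: false; true], v <- FV].
pose s k := if k.+1 < m then k.+1 else 0%N.
pose s' k := if k is k'.+1 then k' else m.-1.
have inFV k : (k \in FV) = (k < m) by rewrite mem_iota.
have inF e k : ((e, k) \in F) = (k < m).
  apply/allpairsP/idP => [[[e' v'] /= [_ + [_ ->]]]|vF]; first by rewrite inFV.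
  by exists (e, k); split=> //; [rewrite !inE; case: e|rewrite inFV].
have ss' k : k \in FV -> [/\ s k \in FV, s' k \in FV, s' (s k) = k & s (s' k) = k].
  rewrite !inFV /s /s' => km; split.
  - by case: ifP; lia.
  - by case: k km => [|k]; lia.
  - by case: ifP => //; lia.
  - by case: k km => [|k] km; case: ifP; lia.
pose sd (j : bool * nat) := (j.1, if j.1 then s' j.2 else s j.2).
pose sd' (j : bool * nat) := (j.1, if j.1 then s j.2 else s' j.2).
have pd : cell_perm F sd sd'.
  case=> [[] v]; rewrite inF -inFV => vF; rewrite /sd /sd' /= !inF -!inFV;
  by have [? ? -> ->] := ss' v vF.
have tw : cell_twist G F E (fun=> 1) by exact: cell_twist1.
have [r [_ mr]] := monomial_exists Gsub (cells F) pd tw.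
have [rE sr] := mr.
have out : exists x, ~ all_cells F E theta x.
  by exists z => -[j Fj [q Eq /(thz j q Eq)]].
have m_gt0 : 0 < m by lia.
exists r; split.
- exact: (doubled_in_G Gsub Gsimple Gvig (cells F) out ss' mr).
- have r0 q k : E q -> k < m -> (r ^+ k) (theta (false, 0%N) q) = theta (false, k) q.
    move=> Eq; elim: k => [//|k IHk] km.
    rewrite expgSr homeo_mulE IHk; last by lia.
    by rewrite rE ?inF//; [rewrite /sd /= /s km|lia].
  have r1 q k : E q -> k < m ->
      (r ^+ k) (theta (true, m.-1) q) = theta (true, m.-1 - k)%N q.
    move=> Eq; elim: k => [|k IHk] km; first by rewrite subn0.
    rewrite expgSr homeo_mulE IHk; last by lia.
    rewrite rE ?inF//; last by lia.
    by rewrite /sd /= /s'; case e : (m.-1 - k)%N => [|i]; [lia|congr (theta (true, _) q); lia].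
  have rm0 q : E q -> (r ^+ m) (theta (false, 0%N) q) = theta (false, 0%N) q.
    move=> Eq; rewrite -(prednK m_gt0) expgSr homeo_mulE r0//; last by lia.
    by rewrite rE ?inF//; [rewrite /sd /= /s prednK// ltnn|lia].
  have rm1 q : E q -> (r ^+ m) (theta (true, m.-1) q) = theta (true, m.-1) q.
    move=> Eq; rewrite -{1}(prednK m_gt0) expgSr homeo_mulE r1//; last by lia.
    by rewrite subnn rE ?inF//.
  apply: homeoP => x; have [[[e k] Fj [q Eq <-]]|nx] := pselect (all_cells F E theta x).
    move: Fj; rewrite inF => km; case: e.
      have -> : k = (m.-1 - (m.-1 - k))%N by lia.
      by rewrite -r1//; [rewrite iter_homeo_fixed//; exact: rm1|lia].
    by rewrite -r0// iter_homeo_fixed//; exact: rm0.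
  have : forall k, (r ^+ k) x = x.
    by elim=> [//|k IHk]; rewrite expgSr homeo_mulE IHk sr.
  by move=> ->.
- apply: supp_inW sr => x [j Fj [q Eq <-]].
  have [->|jj0] := pselect (j = (false, 0%N)); first by left; rewrite th0.
  by right; apply: thD.
- move=> q Eq; exists (theta (false, m.-1) q).
    by apply: thD => // -[]; lia.
  rewrite rE ?inF//; last by lia.
  by rewrite /sd /= /s prednK// ltnn th0.
- have [q Eq] := E0; exists (theta (true, 0%N) q); first exact: thD.
  rewrite rE ?inF//; exact: thD.
Qed.

(** Every element of [G] is a word in elements of exponent m. The list first spells an element u of
    infinite order, then lists letters enough to generate [G], each followed by its inverse so that
    the product remains u. *)
Lemma torsion_generators m : 2 <= m -> finitely_generated G ->
  exists l : seq (homeo CS), [/\ forall a, a \in l -> G a /\ a ^+ m = 1,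
    forall K, is_subgroup K -> (forall a, a \in l -> K a) -> G `<=` K &
    forall k, 0 < k -> (foldr *%g 1 l) ^+ k <> 1].
Proof.
move=> m2 [S [/finite_seqP[sS SE] GS]].
pose T := [set x | G x /\ x ^+ m = 1].
have CS0 : [set: CS] !=set0 by exists point.
have [A [cA _ A0 nA0]] := clopen_split clopenT CS0.
have {}nA0 : (~` A) !=set0 by have [x [_ nAx]] := nA0; exists x.
have cnA := clopen_setC cA.
have words x : G x -> exists l, (forall a, a \in l -> T a) /\ foldr *%g 1 l = x.
  pose K := [set x | exists l, (forall a, a \in l -> T a) /\ foldr *%g 1 l = x].
  have foldr_cat' (l1 l2 : seq (homeo CS)) :
      foldr *%g 1 (l1 ++ l2) = foldr *%g 1 l1 * foldr *%g 1 l2.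
    by elim: l1 => [|a l1 IHl] /=; [rewrite mul1g|rewrite IHl mulgA].
  suff GK : G `<=` K by move/GK.
  apply: (@simple_gen _ G T) => //.
  - by move=> ? [].
  - move=> a g [Ga am] Gg; split; first exact: subgroupJ.
    by rewrite -conjXg am conj1g.
  - have [r [Gr rm _ rE _]] := rotation_exists m2 cA cnA A0 nA0 (fun x nAx => nAx).
    exists r; split=> // r1; have [q Aq] := A0.
    by have [y nAy] := rE q Aq; rewrite r1 => yq; apply: nAy; rewrite [y]yq.
  - apply/is_subgroupP; split; first by exists [::].
      move=> _ _ [l1 [T1 <-]] [l2 [T2 <-]]; exists (l1 ++ l2); split.
        by move=> a; rewrite mem_cat => /orP[/T1|/T2].
      exact: foldr_cat'.
    move=> _ [l [Tl <-]]; exists (rev (map (fun a => a^-1) l)); split.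
      move=> a; rewrite mem_rev => /mapP[b /Tl[Gb bm] ->]; split.
        exact: subgroupV.
      by rewrite expVgn bm invg1.
    elim: l {Tl} => [|a l IHl] /=; first by rewrite invg1.
    by rewrite rev_cons -cats1 foldr_cat' IHl /= mulg1 invgM.
  - move=> a Ta; exists [:: a]; split; last by rewrite /= mulg1.
    by move=> b; rewrite inE => /eqP->.
(* Let u compress [A] into a proper part [A1]; its positive powers send x, chosen in [A] off [A1],
   into [A1], so none of them is 1. *)
have [A1 [cA1 A1A A10 [x [Ax nA1x]]]] := clopen_split cA A0.
have [||u [Gu uA]] := @vigorous_push A A1 cA cA1 A10.
- by have [y nAy] := nA0; exists y.
- by exists x.
have ui k : 0 < k -> u ^+ k <> 1.
  case: k => // k _ uk; apply: nA1x.
  have uAk i y : A y -> A ((u ^+ i) y).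
    by elim: i y => [//|i IHi] y Ay; rewrite expgS homeo_mulE; exact/IHi/A1A/uA.
  have : A1 ((u ^+ k.+1) x) by rewrite expgSr homeo_mulE; exact/uA/uAk.
  by rewrite uk.
have /choice[w Hw] y : exists l, G y -> (forall a, a \in l -> T a) /\ foldr *%g 1 l = y.
  by have [/words[l Hl]|nGy] := pselect (G y); [exists l|exists [::]].
have GsS y : y \in sS -> G y.
  by move=> ys; rewrite GS; apply: sub_generated; rewrite SE.
pose l1 := flatten (map w sS).
have Tl1 a : a \in l1 -> T a.
  by move=> /flatten_mapP[y ys al]; have [+ _] := Hw y (GsS _ ys); exact.
have TV a : T a -> T a^-1.
  by move=> [Ga am]; split; [exact: subgroupV|rewrite expVgn am invg1].
pose l2 := flatten (map (fun a => [:: a; a^-1]) l1).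
have l2E : foldr *%g 1 l2 = 1.
  by rewrite /l2; elim: l1 {Tl1 l2} => [//|a l IHl] /=; rewrite IHl mulg1 mulgV.
have [Tu uE] := Hw u Gu.
exists (w u ++ l2); split.
- move=> a; rewrite mem_cat => /orP[/Tu//|/flatten_mapP[b /Tl1 Tb]].
  by rewrite !inE => /orP[] /eqP ->; [|exact: TV].
- move=> K sK Kl; rewrite GS; apply: generated_sub => // y; rewrite SE /= => ys.
  have [_ <-] := Hw y (GsS _ ys).
  have : forall a, a \in w y -> K a.
    move=> a al; apply: Kl; rewrite mem_cat; apply/orP; right.
    apply/flatten_mapP; exists a; last by rewrite inE eqxx.
    by apply/flatten_mapP; exists y.
  elim: (w y) => [|a l IHl] Ka /=; first exact: subgroup1.
  apply: subgroupM => //; first by apply: Ka; rewrite inE eqxx.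
  by apply: IHl => b bl; apply: Ka; rewrite inE bl orbT.
- rewrite (_ : foldr _ _ _ = u)//; rewrite -[RHS]uE.
  elim: (w u) => [|a l IHl] /=; first exact: l2E.
  by rewrite IHl.
Qed.

End Data.

(* Between two visits to [Y] the maps [a * t] and [t] agree, so the first-return
   map of [a * t] on [Y] is [a], which has exponent m. *)
Lemma periodic_return (a t : homeo CS) (Y : set CS) m N x :
  0 < m -> a ^+ m = 1 -> supp_in Y a ->
  (forall y, Y y -> exists j, 0 < j <= N /\ (t ^+ j) y = y) ->
  (forall y i, Y y -> Y ((t ^+ i) y) -> (t ^+ i) y = y) ->
  (exists j, 0 < j <= N /\ (t ^+ j) x = x) ->
  exists j, 0 < j <= m * N /\ ((a * t) ^+ j) x = x.
Proof.
move=> m0 am sa perY retY [j0 [/andP[j00 j0N] tx]].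
have step k y : ((a * t) ^+ k.+1) y = t (a (((a * t) ^+ k) y)).
  by rewrite expgSr !homeo_mulE.
have off y i : (forall k, k < i -> ~ Y ((t ^+ k) y)) ->
    ((a * t) ^+ i) y = (t ^+ i) y.
  elim: i => [//|i IHi] nY; rewrite step IHi => [|k ki]; last by apply: nY; lia.
  by rewrite sa; [rewrite expgSr homeo_mulE|exact: nY].
have ret1 y : Y y -> exists j, 0 < j <= N /\ ((a * t) ^+ j) y = a y.
  move=> Yy; have Yay : Y (a y) by exact: supp_in_stable.
  have [p [/andP[p0 pN] tp]] := perY _ Yay.
  have exP : exists j, (0 < j) && `[< Y ((t ^+ j) (a y)) >].
    by exists p; rewrite p0 tp; exact/asboolP.
  have [j /andP[j0' /asboolP Yj] jmin] := ex_minnP exP; exists j.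
  have jp : j <= p by apply: jmin; rewrite p0 tp; exact/asboolP.
  split; first by rewrite j0' (leq_trans jp).
  rewrite -[RHS](retY _ _ Yay Yj).
  case: j j0' jmin {Yj jp} => // j _ jmin.
  elim: {-2}j (leqnn j) => [|i IHi] ij; first by rewrite expg1 homeo_mulE.
  rewrite step IHi; last by lia.
  rewrite (sa ((t ^+ i.+1) (a y))); first by rewrite [in RHS]expgSr homeo_mulE.
  by move=> Yi; have := jmin i.+1; rewrite /= (asboolT Yi) => /(_ isT); lia.
have retk y k : Y y -> exists j, k <= j <= k * N /\ ((a * t) ^+ j) y = (a ^+ k) y.
  move=> Yy; elim: k => [|k [j [/andP[kj jkN] tj]]]; first by exists 0%N.
  have Yk : Y ((a ^+ k) y).
    by elim: (k) => [//|i Yi]; rewrite expgSr homeo_mulE; exact: supp_in_stable.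
  have [i [/andP[i0 iN] ti]] := ret1 _ Yk.
  exists (j + i)%N; split; first by rewrite mulSn; lia.
  by rewrite expgnDr homeo_mulE tj ti expgSr homeo_mulE.
have [[i ij Yi]|noY] := pselect (exists2 i, i < j0 & Y ((t ^+ i) x)); last first.
  exists j0; split; first by rewrite j00 (leq_trans j0N)// leq_pmull.
  by rewrite off// => k kj Yk; apply: noY; exists k.
have exP : exists i, `[< Y ((t ^+ i) x) >] by exists i; exact/asboolP.
clear i ij Yi; have [i /asboolP Yi imin] := ex_minnP exP.
(* From the first visit to [Y], m returns act as [a ^+ m]; injectivity carries this period back to
   x. *)
have [j [/andP[mj jN] tj]] := retk _ m Yi.
exists j; split; first by rewrite jN (leq_trans m0 mj).
apply: (@homeo_inj ((a * t) ^+ i)).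
rewrite -homeo_mulE -expgnDr addnC expgnDr homeo_mulE off ?tj ?am//.
by move=> k ki Yk; have := imin k; rewrite (asboolT Yk) => /(_ isT); lia.
Qed.

(** * Filling one cell from its holonomy *)

Section CellFilling.
Variable G : set (homeo CS).
Hypothesis Gsub : is_subgroup G.
Hypothesis Gsimple : simple_group G.
Hypothesis Gvig : vigorous G.
Variables (J : eqType) (F : seq J) (theta : J -> CS -> CS).
Hypothesis cells : cell_family G F setT theta.
Variable c : J.
Hypothesis Fc : c \in F.
Local Notation th := (theta c).
Local Notation C := (cell setT theta c).

Lemma cell_theta q : C (th q). Proof. by exists q. Qed.

Lemma theta_inj q q' : th q = th q' -> q = q'.
Proof. by move=> /(cell_inj cells Fc Fc I I)[]. Qed.

Lemma theta_local q : exists g U, [/\ G g, clopen U, U q &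
  forall q', U q' -> th q' = g q'].
Proof.
have [g [U [Gg cU Uq thU]]] := cell_loc cells Fc (I : setT q).
by exists g, U; split=> // q' Uq'; exact: thU.
Qed.

Lemma pull_back f : G f -> supp_in C f ->
  exists f', locG G f' /\ forall q, th (f' q) = f (th q).
Proof.
move=> Gf sf.
have /choice[k Hk] q : exists q', th q' = f (th q).
  by have [q' _ e] := supp_in_stable sf (cell_theta q); exists q'.
have /choice[k' Hk'] q : exists q', th q' = f^-1 (th q).
  by have [q' _ e] := supp_in_stable (supp_inV sf) (cell_theta q); exists q'.
have K1 : cancel k k' by move=> q; apply: theta_inj; rewrite Hk' Hk homeo_mulKx.
have K2 : cancel k' k by move=> q; apply: theta_inj; rewrite Hk Hk' homeo_mulVKx.
have L (g : homeo CS) (p : CS -> CS) q : G g -> (forall q, th (p q) = g (th q)) ->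
    exists h U, [/\ G h, clopen U, U q & forall y, U y -> p y = h y].
  move=> Gg Hp; have [h1 [U1 [Gh1 cU1 U1q h1U]]] := theta_local q.
  have [h2 [U2 [Gh2 cU2 U2q h2U]]] := theta_local (p q).
  exists (h1 * g * h2^-1), (U1 `&` [set y | U2 ((h1 * g * h2^-1) y)]).
  have pE y : U1 y -> U2 ((h1 * g * h2^-1) y) -> p y = (h1 * g * h2^-1) y.
    move=> U1y U2y; apply: theta_inj; rewrite Hp (h2U _ U2y) (h1U _ U1y).
    by rewrite !homeo_mulE homeo_mulVKx.
  have e : (h1 * g * h2^-1) q = p q.
    by apply: (@homeo_inj h2); rewrite !homeo_mulE homeo_mulVKx -(h2U _ U2q) Hp (h1U _ U1q).
  split.
  - by do !apply: subgroupM => //; exact: subgroupV.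
  - by apply: clopenI => //; exact: pre_clopen.
  - by split=> //; rewrite /mkset e.
  - by move=> y [U1y U2y]; exact: pE.
have C1 : continuous k.
  apply: locally_homeo_continuous => q.
  by have [h [U [_ cU Uq hU]]] := L f k q Gf Hk; exists h, U.
have C2 : continuous k'.
  apply: locally_homeo_continuous => q.
  by have [h [U [_ cU Uq hU]]] := L f^-1 k' q (subgroupV Gsub Gf) Hk'; exists h, U.
exists (Homeo K1 K2 C1 C2); split=> [q|q]; last exact: Hk.
exact: (L f k q Gf Hk).
Qed.

(** [N] consists of the elements of [G] that [H] realises on the cell with support in the cell.
    Holonomy makes [N] invariant under conjugation, k makes it nontrivial, so it is all of [G]. The
    commutators in question pull back to commutators of homeomorphisms locally in [G]; these lie in
    [G] because q0 is left free, and [N] brings them into [H]. *)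
Lemma filled_cell (H : set (homeo CS)) (l : seq (homeo CS)) (k u : homeo CS) :
  is_subgroup H ->
  (forall K, is_subgroup K -> (forall a, a \in l -> K a) -> G `<=` K) ->
  (forall a, a \in l -> exists2 h, H h & forall q, h (th q) = th (a q)) ->
  H k -> supp_in C k -> (forall q, k (th q) = th (u q)) -> G u -> u <> 1 ->
  filled G H C.
Proof.
move=> sH gen_l hol_l Hk sk kE Gu u1.
have hol g : G g -> exists2 h, H h & forall q, h (th q) = th (g q).
  pose K := [set g : homeo CS | exists2 h, H h & forall q, h (th q) = th (g q)].
  suff GK : G `<=` K by move/GK.
  apply: gen_l => //; apply/is_subgroupP; split.
  - by exists 1; first exact: subgroup1.
  - move=> g1 g2 [h1 Hh1 h1E] [h2 Hh2 h2E]; exists (h1 * h2).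
      exact: subgroupM.
    by move=> q; rewrite !homeo_mulE h1E h2E.
  - move=> g1 [h1 Hh1 h1E]; exists h1^-1; first exact: subgroupV.
    by move=> q; apply: (@homeo_inj h1); rewrite h1E !homeo_mulVKx.
pose N := [set g | G g /\ exists h, [/\ H h, supp_in C h &
  forall q, h (th q) = th (g q)]].
have sN : is_subgroup N.
  apply/is_subgroupP; split.
  - by split; [exact: subgroup1|exists 1; split=> //; exact: subgroup1].
  - move=> g1 g2 [Gg1 [h1 [Hh1 sh1 h1E]]] [Gg2 [h2 [Hh2 sh2 h2E]]].
    split; [exact: subgroupM|exists (h1 * h2); split; [exact: subgroupM| |]].
      exact: supp_inM.
    by move=> q; rewrite !homeo_mulE h1E h2E.
  - move=> g1 [Gg1 [h1 [Hh1 sh1 h1E]]].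
    split; [exact: subgroupV|exists h1^-1; split; [exact: subgroupV| |]].
      exact: supp_inV.
    by move=> q; apply: (@homeo_inj h1); rewrite h1E !homeo_mulVKx.
have GN : G `<=` N.
  apply: (@simple_gen _ G N) => //.
  - by move=> ? [].
  - move=> g x [Gg [h [Hh sh hE]]] Gx; split; first exact: subgroupJ.
    have [e He eE] := hol x Gx.
    have eVE q : e^-1 (th q) = th (x^-1 q).
      by apply: (@homeo_inj e); rewrite eE !homeo_mulVKx.
    exists (h ^ e); split; first exact: subgroupJ.
      apply: (@supp_inW (im e C)); last exact: supp_inJ.
      move=> y; rewrite /im /mkset => -[q _ qE].
      by rewrite -(homeo_mulVKx e y) -qE eE; exact: cell_theta.
    by move=> q; rewrite !conjgE !homeo_mulE eVE hE eE.
  - by exists u; split=> //; split=> //; exists k.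
move=> W f g cW WC [_ [[q0 _ <-] nWq0]] Gf Gg sf sg.
have [f' [lf f'E]] := pull_back Gf (supp_inW WC sf).
have [g' [lg g'E]] := pull_back Gg (supp_inW WC sg).
pose W' : set CS := [set q | W (th q)].
have th_cont : continuous th.
  apply: locally_homeo_continuous => q.
  by have [h [U [_ cU Uq hU]]] := theta_local q; exists h, U.
have cW' : clopen W' by apply: preimage_clopen.
have sf' : supp_in W' f' by move=> q nW; apply: theta_inj; rewrite f'E sf.
have sg' : supp_in W' g' by move=> q nW; apply: theta_inj; rewrite g'E sg.
have /GN[_ [h [Hh sh hE]]] : G [~ f', g'].
  by apply: (locG_commg Gsub Gsimple Gvig lf lg cW' sf' sg'); exists q0.
suff -> : [~ f, g] = h by [].
have VE (a b : homeo CS) : (forall q, th (a q) = b (th q)) ->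
    forall q, th (a^-1 q) = b^-1 (th q).
  by move=> abE q; apply: (@homeo_inj b); rewrite -abE !homeo_mulVKx.
apply: homeoP => x; have [[q _ <-]|nCx] := pselect (C x).
  rewrite hE !commgEl !conjgE !homeo_mulE.
  by rewrite g'E f'E (VE _ _ g'E) (VE _ _ f'E).
rewrite sh//; apply: (supp_inR (supp_inW WC sf) (supp_inW WC sg)) => //.
Qed.

End CellFilling.

(** * The two generators *)

Section Design.
Variable G : set (homeo CS).
Hypothesis Gsub : is_subgroup G.
Variables m n : nat.
Hypothesis m2 : 2 <= m.
Hypothesis n3 : 3 <= n.
Variable l : seq (homeo CS).
Hypothesis l_torsion : forall a, a \in l -> G a /\ a ^+ m = 1.
Let h : homeo CS := foldr *%g 1 l.
Let r := size l.
Local Notation s := (nb_rows m n).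
Local Notation L := (nb_cols m r).

(* Under [s_map], column 0 is multiplied by h, columns 1, ..., m-2 are fixed and
   the others form one orbit, along which the twists h^-1, a_1, ..., a_r
   multiply to 1. *)
Definition a_twist i : homeo CS :=
  if i == 0 then h else if i == m.-1 then h^-1
  else if (m <= i) && (i < m + r) then nth 1 l ((m + r).-1 - i) else 1.

(** Row 0 applies [s_map] and the last row undoes it by [s_map'], so the m-cycle of rows closes
    without twist; row 1 applies [a_map]. The second copy only balances the permutation. *)
Definition alpha_twist (j : bool * (nat * nat)) : homeo CS :=
  let: (e, (w, i)) := j in
  if e then 1 else if (w == 0) || (w == 1%N) then a_twist i
  else if w == s.-1 then (a_twist (s_idx' m r i))^-1 else 1.

Definition a_map (z : nat * CS) := (a_idx m z.1, a_twist z.1 z.2).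
Definition a_map' (z : nat * CS) :=
  (a_idx' m z.1, (a_twist (a_idx' m z.1))^-1 z.2).
Definition b_map (z : nat * CS) := (b_idx m r z.1, z.2).
Definition b_map' (z : nat * CS) := (b_idx' m r z.1, z.2).
Definition s_map z := b_map' (a_map z).
Definition s_map' z := a_map' (b_map z).

Local Notation valid z := (z.1 < L).

Lemma a_mapP z : valid z -> [/\ valid (a_map z), valid (a_map' z),
  a_map' (a_map z) = z & a_map (a_map' z) = z].
Proof.
case: z => i q /= iL; have [a1 a2 a3 a4] := a_idxP m2 n3 iL.
by rewrite /a_map /a_map' /= a3 a4 homeo_funK homeo_invK.
Qed.

Lemma b_mapP z : valid z -> [/\ valid (b_map z), valid (b_map' z),
  b_map' (b_map z) = z & b_map (b_map' z) = z].
Proof.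
case: z => i q /= iL; have [a1 a2 a3 a4] := b_idxP m2 n3 iL.
by rewrite /b_map /b_map' /= a3 a4.
Qed.

Lemma s_mapP z : valid z -> [/\ valid (s_map z), valid (s_map' z),
  s_map' (s_map z) = z & s_map (s_map' z) = z].
Proof.
move=> zL; rewrite /s_map /s_map'.
have [a1 a2 a3 a4] := a_mapP zL; have [b1 b2 b3 b4] := b_mapP zL.
have [c1 c2 c3 c4] := a_mapP b1; have [d1 d2 d3 d4] := b_mapP a1.
by rewrite d4 c4.
Qed.

Lemma iter_b_map k z : iter k b_map z = (iter k (b_idx m r) z.1, z.2).
Proof. by elim: k => [|k IHk]; [case: z|rewrite iterS IHk]. Qed.

Lemma b_map_period z : valid z -> iter L b_map z = z.
Proof.
by move=> zL; rewrite iter_b_map (iter_b_idx m2 n3)//; case: z zL.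
Qed.

Lemma valid_iter (f : nat * CS -> nat * CS) k z :
  (forall z, valid z -> valid (f z)) -> valid z ->
  valid (iter k f z).
Proof. by move=> fL zL; elim: k => [//|k IHk]; exact: fL. Qed.

Lemma iter_a_map k q : k < m.-1 -> iter k.+1 a_map (0, q) = (k.+1, h q).
Proof.
elim: k => [|k IHk] km; first by rewrite /= /a_map /= /a_idx km.
rewrite iterS IHk; last by lia.
rewrite /a_map /= /a_idx /a_twist /=.
have -> : k.+1 < m.-1 by lia.
have -> : (k.+1 == m.-1) = false by lia.
by have -> : (m <= k.+1) = false by lia.
Qed.

Lemma a_map_period z : valid z -> iter m a_map z = z.
Proof.
case: z => i q /= iL.
have mE : m = m.-2.+2 by lia.
have per0 p : iter m a_map (0, p) = (0, p).
  have -> : iter m a_map (0, p) = a_map (iter m.-2.+1 a_map (0, p)).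
    by rewrite {1}mE iterS.
  rewrite iter_a_map; last by lia.
  rewrite /a_map /a_idx /a_twist /=.
  have -> : (m.-2.+1 < m.-1) = false by lia.
  have -> : (m.-2.+1 == m.-1) by lia.
  by rewrite homeo_mulKx.
have [->//|i0] := eqVneq i 0.
have [im|mi] := ltnP i m.
  have -> : (i, q) = iter i.-1.+1 a_map (0, h^-1 q).
    by rewrite iter_a_map; [rewrite homeo_mulVKx; congr pair; lia|lia].
  by rewrite -iterD addnC iterD per0.
have aE : a_idx m i = i by rewrite /a_idx; repeat case: ifP; lia.
have -> k : iter k a_map (i, q) = (i, (a_twist i ^+ k) q).
  elim: k => [//|k IHk]; rewrite iterS IHk /a_map /= aE.
  by rewrite expgSr homeo_mulE.
suff -> : a_twist i ^+ m = 1 by [].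
rewrite /a_twist; have -> : (i == 0) = false by lia.
have -> : (i == m.-1) = false by lia.
case: ifP => [/andP[_ imr]|_]; last exact: expg1n.
by case: (@l_torsion (nth 1 l ((m + r).-1 - i))) => //; apply: mem_nth; rewrite -/r; lia.
Qed.

Lemma s_map_fixed i q : 0 < i < m.-1 -> s_map (i, q) = (i, q).
Proof.
move=> im; rewrite /s_map /b_map' /a_map /= /a_idx /a_twist /b_idx'.
have -> : i < m.-1 by lia.
have -> : (i == 0) = false by lia.
have -> : (i == m.-1) = false by lia.
by have -> : (m <= i) = false by lia.
Qed.

(** The first two steps leave column m-1 through h^-1 and cross the untwisted last column; each
    further step reads one more letter of [l]. *)
Lemma iter_s_map k q : k <= r -> iter k.+2 s_map (m.-1, q) =
  ((m + r).-1 - k, foldr *%g 1 (take k l) (h^-1 q)).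
Proof.
elim: k => [_|k IHk kr].
  rewrite 2!iterS take0 /= /s_map /b_map' /a_map /= /a_idx ltnn eqxx.
  rewrite {2}/b_idx' /= /b_idx' /= /a_twist.
  have -> : (m.-1 == 0) = false by lia.
  have -> : (m + r < m.-1) = false by lia.
  have -> : (m + r == m.-1) = false by lia.
  have -> : (m + r == 0) = false by lia.
  by rewrite eqxx ltnn andbF subn0.
rewrite iterS IHk; last exact: ltnW.
rewrite /s_map /b_map' /a_map /= /a_idx /a_twist /b_idx'.
have -> : ((m + r).-1 - k < m.-1) = false by lia.
have -> : ((m + r).-1 - k == m.-1) = false by lia.
have -> : ((m + r).-1 - k == 0) = false by lia.
have -> : (m <= (m + r).-1 - k) by lia.
have -> : ((m + r).-1 - k < m + r) by lia.
have -> : ((m + r).-1 - ((m + r).-1 - k) = k)%N by lia.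
congr pair; first by lia.
rewrite /= -homeo_mulE (take_nth 1 kr) -cats1.
congr (homeo_fun _ _); elim: (take k l) => [|a t IHt] /=; first by rewrite mul1g mulg1.
by rewrite -mulgA IHt.
Qed.

Lemma s_map_period z : valid z -> z.1 != 0 -> iter r.+2 s_map z = z.
Proof.
case: z => i q iL i0; change (is_true (i < L)) in iL; change (is_true (i != 0)) in i0.
have per q' : iter r.+2 s_map (m.-1, q') = (m.-1, q').
  by rewrite iter_s_map// take_size -/h homeo_mulVKx; congr pair; lia.
have shift j q' : iter r.+2 s_map (iter j s_map (m.-1, q')) = iter j s_map (m.-1, q').
  by rewrite -iterD addnC iterD per.
have [im|mi] := ltnP i m.-1.
  have fixed k : iter k s_map (i, q) = (i, q).
    by elim: k => [//|k IHk]; rewrite iterS IHk s_map_fixed//; lia.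
  exact: fixed.
have [->//|im] := eqVneq i m.-1.
have [iE|imr] := eqVneq i (m + r).
  suff -> : (i, q) = iter 1 s_map (m.-1, h q) by exact: shift.
  rewrite /= /s_map /b_map' /a_map /= /a_idx ltnn eqxx /b_idx' /= /a_twist.
  have -> : (m.-1 == 0) = false by lia.
  by rewrite eqxx homeo_mulKx iE.
pose k := ((m + r).-1 - i)%N.
have kr : k <= r by rewrite /k; lia.
suff -> : (i, q) = iter k.+2 s_map (m.-1, h ((foldr *%g 1 (take k l))^-1 q)).
  exact: shift.
rewrite iter_s_map// homeo_mulKx homeo_mulVKx; congr pair; move: iL.
by rewrite /k /nb_cols; lia.
Qed.

Lemma G_h : G h.
Proof.
rewrite /h; have : forall a, a \in l -> G a by move=> a /l_torsion[].
elim: (l) => [|a l' IHl] Gl /=; first exact: subgroup1.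
apply: subgroupM => //; first by apply: Gl; rewrite inE eqxx.
by apply: IHl => b bl; apply: Gl; rewrite inE bl orbT.
Qed.

Lemma a_twist_in_G i : G (a_twist i).
Proof.
rewrite /a_twist; case: ifP => _; first exact: G_h.
case: ifP => _; first by apply: subgroupV => //; exact: G_h.
case: ifP => [/andP[im ir]|_]; last exact: subgroup1.
by case: (@l_torsion (nth 1 l ((m + r).-1 - i))) => //; apply: mem_nth; rewrite -/r; lia.
Qed.

(** * Dynamics of the generators without the link *)

Variable theta : bool * (nat * nat) -> CS -> CS.
Let FV := indices m n r.
Let F := [seq (e, v) | e <- [:: false; true], v <- FV].
Hypothesis cells : cell_family G F setT theta.

Lemma mem_F e v : ((e, v) \in F) = (v \in FV).
Proof.
apply/allpairsP/idP => [[[e' v'] /= [_ + [_ ->]]]//|vF].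
by exists (e, v); split=> //; rewrite !inE; case: e.
Qed.

Variables alpha0 beta : homeo CS.
Hypothesis alpha0P : monomial F setT theta alpha0
  (fun j => (j.1, if j.1 then alpha_idx' m n r j.2 else alpha_idx m n r j.2))
  alpha_twist.
Hypothesis betaP : monomial F setT theta beta
  (fun j => (j.1, if j.1 then beta_idx' n j.2 else beta_idx n j.2)) (fun=> 1).

Definition pt w (z : nat * CS) := theta (false, (w, z.1)) z.2.

Lemma s_ge3 : 2 < s. Proof. by rewrite /nb_rows; lia. Qed.

Lemma mem_cell e w i : w < s -> i < L -> (e, (w, i)) \in F.
Proof. by move=> ws iL; rewrite mem_F mem_indices ws iL. Qed.

Lemma alpha0_pt w z : w < s -> valid z -> alpha0 (pt w z) =
  if w == 0 then pt n.-1 (s_map z) else if w == 1%N then pt 1%N (a_map z)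
  else if w < n.-1 then pt w z else if w < s.-1 then pt w.+1 z
  else pt 0 (s_map' z).
Proof.
move=> ws zL; rewrite /pt alpha0P.1 ?mem_cell// /alpha_idx /alpha_twist /=.
have s3 := s_ge3.
case: (eqVneq w 0) => [//|w0]; case: (eqVneq w 1%N) => [//|w1] /=.
case: ltnP => wn.
  by have -> : (w == s.-1) = false by move: wn; rewrite /nb_rows; lia.
case: ltnP => wl.
  by have -> : (w == s.-1) = false by lia.
by have -> : (w == s.-1) by lia.
Qed.

Lemma beta_pt w z : w < s -> valid z -> beta (pt w z) =
  pt (if w < n.-1 then w.+1 else if w == n.-1 then 0 else w) z.
Proof. by move=> ws zL; rewrite /pt betaP.1 ?mem_cell. Qed.

Lemma beta_true v q : v \in FV -> beta (theta (true, v) q) = theta (true, beta_idx' n v) q.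
Proof. by move=> vF; rewrite betaP.1 ?mem_F. Qed.

Lemma alpha0_true v q : v \in FV ->
  alpha0 (theta (true, v) q) = theta (true, alpha_idx' m n r v) q.
Proof. by case: v => w i vF; rewrite alpha0P.1 ?mem_F. Qed.

Lemma pt_inj w z w' z' : w < s -> valid z -> w' < s -> valid z' ->
  pt w z = pt w' z' -> w = w' /\ z = z'.
Proof.
case: z z' => i q [i' q'] ws iL ws' iL' e.
have := cell_inj cells (mem_cell false ws iL) (mem_cell false ws' iL') I I e.
by case=> -[-> ->] /= ->.
Qed.

Lemma iter_idx f sg g k v q : monomial F setT theta f
    (fun j => (j.1, if j.1 then sg true j.2 else sg false j.2)) g ->
  (forall v, v \in FV -> sg false v \in FV) -> v \in FV ->
  exists q', (f ^+ k) (theta (false, v) q) = theta (false, iter k (sg false) v) q'.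
Proof.
move=> [fE _] sF vF; have kF j : iter j (sg false) v \in FV.
  by elim: j => [//|j IHj]; exact: sF.
elim: k => [|k [q' IHk]]; first by exists q.
by rewrite expgSr homeo_mulE IHk fE ?mem_F//; eexists.
Qed.

Lemma alpha0_cycle k z : valid z -> k < m.-1 ->
  (alpha0 ^+ k) (pt n.-1 z) = pt (n.-1 + k) z.
Proof.
move=> zL; elim: k => [|k IHk] km; first by rewrite addn0.
rewrite expgSr homeo_mulE IHk; last by lia.
rewrite alpha0_pt//; last by rewrite /nb_rows; lia.
have -> : (n.-1 + k == 0) = false by lia.
have -> : (n.-1 + k == 1%N) = false by lia.
have -> : (n.-1 + k < n.-1) = false by lia.
have -> : n.-1 + k < s.-1 by rewrite /nb_rows; lia.
by rewrite addnS.
Qed.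

Lemma alpha0_cycle0 z : valid z -> (alpha0 ^+ m.-1) (pt n.-1 z) = pt 0 (s_map' z).
Proof.
move=> zL; have -> : m.-1 = m.-2.+1 by lia.
rewrite expgSr homeo_mulE alpha0_cycle//; last by lia.
rewrite alpha0_pt//; last by rewrite /nb_rows; lia.
have -> : (n.-1 + m.-2 == 0) = false by lia.
have -> : (n.-1 + m.-2 == 1%N) = false by lia.
have -> : (n.-1 + m.-2 < n.-1) = false by lia.
by have -> : (n.-1 + m.-2 < s.-1) = false by rewrite /nb_rows; lia.
Qed.

Lemma alpha0_cycle_period z : valid z -> (alpha0 ^+ m) (pt n.-1 z) = pt n.-1 z.
Proof.
move=> zL; have -> : m = m.-1.+1 by lia.
have [_ sL _ sK] := s_mapP zL.
rewrite expgSr homeo_mulE alpha0_cycle0// alpha0_pt//; last exact: ltn_trans s_ge3.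
by rewrite eqxx sK.
Qed.

Lemma alpha0_period w z : w < s -> valid z -> (alpha0 ^+ m) (pt w z) = pt w z.
Proof.
move=> ws zL; have s3 := s_ge3.
have [->|w0] := eqVneq w 0.
  have [sL _ sK _] := s_mapP zL.
  by rewrite -{1 2}sK -alpha0_cycle0// iter_homeo_fixed// alpha0_cycle_period.
have [w1|w1] := eqVneq w 1%N.
  rewrite w1; have -> : (alpha0 ^+ m) (pt 1%N z) = pt 1%N (iter m a_map z).
    elim: {1 2}m => [//|k IHk]; rewrite expgSr homeo_mulE IHk alpha0_pt//; first lia.
    by apply: valid_iter => // z' /a_mapP[].
  by rewrite a_map_period.
have [wn|wn] := ltnP w n.-1.
  elim: {1}m => [//|k IHk]; rewrite expgSr homeo_mulE IHk alpha0_pt//.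
  by rewrite (negbTE w0) (negbTE w1) wn.
have -> : w = (n.-1 + (w - n.-1))%N by lia.
have km : w - n.-1 < m.-1 by move: ws; rewrite /nb_rows; lia.
by rewrite -alpha0_cycle// iter_homeo_fixed// alpha0_cycle_period.
Qed.

Lemma beta_cycle k z : valid z -> k < n -> (beta ^+ k) (pt 0 z) = pt k z.
Proof.
move=> zL; elim: k => [//|k IHk] kn.
rewrite expgSr homeo_mulE IHk; last exact: ltnW.
rewrite beta_pt//; last by rewrite /nb_rows; lia.
by have -> : k < n.-1 by lia.
Qed.

Lemma beta_period w z : w < s -> valid z -> (beta ^+ n) (pt w z) = pt w z.
Proof.
move=> ws zL; have [wn|nw] := ltnP w n.
  rewrite -beta_cycle// iter_homeo_fixed//.
  have {1}-> : n = n.-1.+1 by lia.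
  rewrite expgSr homeo_mulE beta_cycle//; last by lia.
  rewrite beta_pt//; last by rewrite /nb_rows; lia.
  by rewrite ltnn eqxx.
elim: {1}n => [//|k IHk]; rewrite expgSr homeo_mulE IHk beta_pt//.
have -> : (w < n.-1) = false by lia.
by have -> : (w == n.-1) = false by lia.
Qed.

(** A period of [f] on the first copy, twists included, is a period of the index permutation; its
    inverse, which governs the untwisted second copy, then has the same period. *)
Lemma idx_period f sg g k v : monomial F setT theta f
    (fun j => (j.1, if j.1 then sg true j.2 else sg false j.2)) g ->
  (forall v, v \in FV -> [/\ sg false v \in FV, sg true v \in FV,
     sg true (sg false v) = v & sg false (sg true v) = v]) ->
  (forall w z, w < s -> valid z -> (f ^+ k) (pt w z) = pt w z) ->
  v \in FV -> iter k (sg true) v = v.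
Proof.
move=> fm sgP fk vF.
have sF u : u \in FV -> sg false u \in FV by case/sgP.
suff e : iter k (sg false) v = v.
  by rewrite -{1}e; apply: (iter_can_in (F := FV)) => // u /sgP[].
have [q' e] : exists q',
    (f ^+ k) (theta (false, v) point) = theta (false, iter k (sg false) v) q'.
  exact: (iter_idx k point fm).
have kF : iter k (sg false) v \in FV by elim: (k) => [//|i IHi]; exact: sF.
case: v vF e kF => w i + e kF; rewrite mem_indices => /andP[ws iL].
move: e; rewrite (fk w (i, point))//= => e.
have [] := cell_inj cells (mem_cell false ws iL) _ I I e; first by rewrite mem_F.
by case=> <-.
Qed.

Lemma pow_true (f : homeo CS) sg k v q :
  (forall v q, v \in FV -> f (theta (true, v) q) = theta (true, sg v) q) ->
  (forall v, v \in FV -> sg v \in FV) -> v \in FV ->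
  (f ^+ k) (theta (true, v) q) = theta (true, iter k sg v) q.
Proof.
move=> fE sF vF; elim: k => [//|k IHk]; rewrite expgSr homeo_mulE IHk fE//.
by elim: (k) => [//|i IHi]; exact: sF.
Qed.

Lemma cell_cases x : [\/ exists w z, [/\ w < s, valid z & x = pt w z],
  exists v q, v \in FV /\ x = theta (true, v) q | ~ all_cells F setT theta x].
Proof.
have [[[[] v] + [q _ <-]]|nx] := pselect (all_cells F setT theta x).
- by rewrite mem_F => vF; apply: Or32; exists v, q.
- case: v => w i; rewrite mem_F mem_indices => /andP[ws iL].
  by apply: Or31; exists w, (i, q).
- exact: Or33.
Qed.

Lemma pow_out (f : homeo CS) k x : supp_in (all_cells F setT theta) f ->
  ~ all_cells F setT theta x -> (f ^+ k) x = x.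
Proof.
by move=> sf nx; elim: k => [//|k IHk]; rewrite expgSr homeo_mulE IHk sf.
Qed.

Lemma alpha0_expm : alpha0 ^+ m = 1.
Proof.
apply: homeoP => x; have [[w [z [ws zL ->]]]|[v [q [vF ->]]]|nx] := cell_cases x.
- exact: alpha0_period.
- have aF u : u \in FV -> alpha_idx' m n r u \in FV by case/(alpha_idxP m2 n3).
  rewrite (pow_true _ _ alpha0_true)//; congr (theta (true, _) q).
  apply: (@idx_period alpha0
    (fun e => if e then alpha_idx' m n r else alpha_idx m n r) alpha_twist) => //.
  + by move=> u uF; case: (alpha_idxP m2 n3 uF).
  + exact: alpha0_period.
- by apply: pow_out => //; case: alpha0P.
Qed.

Lemma beta_expn : beta ^+ n = 1.
Proof.
apply: homeoP => x; have [[w [z [ws zL ->]]]|[v [q [vF ->]]]|nx] := cell_cases x.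
- exact: beta_period.
- have bF u : u \in FV -> beta_idx' n u \in FV by case/(beta_idxP m2 n3).
  rewrite (pow_true _ _ beta_true)//; congr (theta (true, _) q).
  apply: (@idx_period beta
    (fun e => if e then beta_idx' n else beta_idx n) (fun=> 1)) => //.
  + by move=> u uF; case: (beta_idxP m2 n3 uF).
  + exact: beta_period.
- by apply: pow_out => //; case: betaP.
Qed.

Let t0 : homeo CS := alpha0 * beta.

Lemma t0_pt w z : w < s -> valid z -> t0 (pt w z) =
  if w == 0 then pt 0 (s_map z) else if w == 1%N then pt 2 (a_map z)
  else if w < s.-1 then pt w.+1 z else pt 1%N (s_map' z).
Proof.
move=> ws zL; have s3 := s_ge3; have ns : n <= s by rewrite /nb_rows; lia.
have [aL _ _ _] := a_mapP zL; have [sL sL' _ _] := s_mapP zL.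
rewrite homeo_mulE alpha0_pt//; case: eqVneq => w0.
  rewrite beta_pt//; last by lia.
  by rewrite ltnn eqxx.
case: eqVneq => w1.
  by rewrite beta_pt//; [have -> : 1 < n.-1 by lia|lia].
case: ltnP => wn.
  by rewrite beta_pt// wn; have -> : w < s.-1 by lia.
case: ltnP => wl; last by rewrite beta_pt//; [have -> : 0 < n.-1 by lia|lia].
rewrite beta_pt//; last by lia.
have -> : (w.+1 < n.-1) = false by lia.
by have -> : (w.+1 == n.-1) = false by lia.
Qed.

Lemma t0_row0 k z : valid z -> (t0 ^+ k) (pt 0 z) = pt 0 (iter k s_map z).
Proof.
move=> zL; have s3 := s_ge3.
elim: k => [//|k IHk]; rewrite expgSr homeo_mulE IHk t0_pt//; first by lia.
by apply: valid_iter => // z' /s_mapP[].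
Qed.

Lemma t0_up k z : valid z -> k.+2 < s -> (t0 ^+ k.+1) (pt 1%N z) = pt k.+2 (a_map z).
Proof.
move=> zL; have s3 := s_ge3; have [aL _ _ _] := a_mapP zL.
elim: k => [|k IHk] ks; first by rewrite expg1 t0_pt//; lia.
rewrite expgSr homeo_mulE IHk; last exact: ltnW.
rewrite t0_pt//; last exact: ltnW.
by have -> : k.+2 < s.-1 by lia.
Qed.

Lemma t0_return z : valid z ->
  (t0 ^+ s.-1) (pt 1%N z) = pt 1%N (a_map' (b_map (a_map z))).
Proof.
move=> zL; have s3 := s_ge3; have [aL _ _ _] := a_mapP zL.
have {1}-> : s.-1 = (s - 3).+2 by lia.
rewrite expgSr homeo_mulE t0_up//; last by lia.
rewrite t0_pt//; last by lia.
by have -> : ((s - 3).+2 < s.-1) = false by lia.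
Qed.

(* The first return of [t0] to row 1 is the cyclic shift of the columns,
   conjugated by [a_map]: all its orbits have length dividing L. *)
Lemma t0_returns k z : valid z ->
  (t0 ^+ (s.-1 * k)) (pt 1%N z) = pt 1%N (a_map' (iter k b_map (a_map z))).
Proof.
move=> zL; have [aL _ aK _] := a_mapP zL.
have vk i : valid (iter i b_map (a_map z)) by apply: valid_iter => // y /b_mapP[].
elim: k => [|k IHk]; first by rewrite muln0 aK.
rewrite mulnS addnC expgnDr homeo_mulE IHk t0_return.
  by have [_ _ _ ->] := a_mapP (vk k).
by have [] := a_mapP (vk k).
Qed.

Lemma t0_row_period w z : 0 < w -> w < s -> valid z ->
  (t0 ^+ (s.-1 * L)) (pt w z) = pt w z.
Proof.
move=> w0 ws zL; have [_ aL _ aK] := a_mapP zL.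
have per z' : valid z' -> (t0 ^+ (s.-1 * L)) (pt 1%N z') = pt 1%N z'.
  move=> zL'; have [aL' _ aK' _] := a_mapP zL'.
  by rewrite t0_returns// b_map_period// aK'.
case: w w0 ws => [//|[|w]] _ ws; first exact: per.
by rewrite -{1 2}aK -t0_up// iter_homeo_fixed// per.
Qed.

Lemma t0_true v q : v \in FV ->
  t0 (theta (true, v) q) = theta (true, beta_idx' n (alpha_idx' m n r v)) q.
Proof.
move=> vF; rewrite homeo_mulE alpha0_true// beta_true//.
by case: (alpha_idxP m2 n3 vF).
Qed.

Lemma t0_true_period v q : v \in FV ->
  exists j, 0 < j <= size FV /\ (t0 ^+ j) (theta (true, v) q) = theta (true, v) q.
Proof.
move=> vF; pose sg u := beta_idx' n (alpha_idx' m n r u).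
have sgF u : u \in FV -> sg u \in FV.
  by move=> /(alpha_idxP m2 n3)[_ /(beta_idxP m2 n3)[]].
have [|j [jF jE]] := @iter_period _ FV sg (fun u => alpha_idx m n r (beta_idx n u)) v _ vF.
  move=> u uF; split; first exact: sgF.
  have [_ aF _ aK] := alpha_idxP m2 n3 uF; have [_ _ _ bK] := beta_idxP m2 n3 aF.
  by rewrite /sg bK.
exists j; split=> //; rewrite (pow_true _ _ t0_true)// jE//.
Qed.

Let top : nat := L.-1.
(** The link will join [Y0] to [Y1]: to the matching cell of the second copy and to the rest of the
    space, which [alpha0] and [beta] never connect to the first copy. *)
Let Y1 : set CS := cell setT theta (true, (1%N, top)) `|` ~` all_cells F setT theta.
Let Y0 : set CS := cell setT theta (false, (1%N, top)).
Let Y : set CS := Y1 `|` Y0.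
(** One summand for each kind of orbit of [t0]: the rows from 1 on, row 0 away from column 0, and
    the second copy. *)
Let N := (s.-1 * L + r.+2 + size FV)%N.

Lemma top_in e : (e, (1%N, top)) \in F.
Proof. by rewrite mem_cell//; have := s_ge3; lia. Qed.

Lemma t0_out k x : ~ all_cells F setT theta x -> (t0 ^+ k) x = x.
Proof.
by move=> nx; apply: pow_out nx; apply: supp_inM; [case: alpha0P|case: betaP].
Qed.

Lemma a_map_top q : a_map (top, q) = (top, q).
Proof.
rewrite /a_map /top /a_idx /a_twist /nb_cols /=.
have -> : (m + r < m.-1) = false by lia.
have -> : (m + r == m.-1) = false by lia.
have -> : (m + r == 0) = false by lia.
by rewrite ltnn andbF.
Qed.

Lemma pt_not_true w z v q : w < s -> valid z -> v \in FV ->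
  pt w z <> theta (true, v) q.
Proof.
case: z => i p ws iL vF e.
by have [] := cell_inj cells (mem_cell false ws iL) _ I I e; rewrite ?mem_F.
Qed.

Lemma pt_cell w z : w < s -> valid z -> all_cells F setT theta (pt w z).
Proof. by case: z => i q ws iL; exact: in_all_cells (mem_cell false ws iL) _. Qed.

Lemma pt_in_Y w z : w < s -> valid z -> Y (pt w z) -> w = 1%N /\ z.1 = top.
Proof.
have s3 := s_ge3; have tL : top < L by [].
have tF : (1%N, top) \in FV by rewrite -(mem_F true) top_in.
move=> ws zL [[[q _ /esym e]|nC]|[q _ e]].
- by case: (pt_not_true ws zL tF e).
- by case: nC; exact: pt_cell.
- by have [|//|//|//|//|<- <-] := @pt_inj 1%N (top, q) w z; first by lia.
Qed.

(** Returns to row 1 are conjugate to the untwisted shift by [a_map], which is the identity on the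
    last column; the second copy has no twist, and points outside the cells are fixed. This is the
    absence of holonomy that [periodic_return] requires. *)
Lemma t0_Y y k : Y y -> Y ((t0 ^+ k) y) -> (t0 ^+ k) y = y.
Proof.
have s3 := s_ge3; have tL : top < L by [].
have tF : (1%N, top) \in FV by rewrite -(mem_F true) top_in.
case=> [[[q _ <-]|nC]|[q _ <-]]; last 1 first.
- have zL : valid (top, q) by [].
  have vk i : valid (iter i b_map (a_map (top, q))).
    by apply: valid_iter => [y' /b_mapP[]//|]; case: (a_mapP zL).
  (* Split k into full returns to row 1 and a remainder; a nonzero remainder ends in another row,
     hence off [Y]. *)
  rewrite {1 2}(divn_eq k s.-1) mulnC expgnDr homeo_mulE.
  rewrite -/(pt 1%N (top, q)) t0_returns//.
  set z' := a_map' _ => Yk.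
  have zL' : valid z' by case: (a_mapP (vk (k %/ s.-1))).
  have jl : k %% s.-1 < s.-1 by rewrite ltn_mod; lia.
  move: Yk; case: (k %% s.-1) jl => [|j] jl Yk; last first.
    have [aL _ _ _] := a_mapP zL'.
    by move: Yk; rewrite t0_up//; [move/pt_in_Y => -[]//; lia|lia].
  have [|_ z1] := pt_in_Y _ zL' Yk; first by lia.
  congr (pt 1%N _); have [_ _ _ aK] := a_mapP (vk (k %/ s.-1)).
  move: aK; rewrite -/z'.
  case: z' z1 zL' {Yk} => i p /= -> _; rewrite !a_map_top iter_b_map /=.
  by case=> _ ->.
- have sgF u : u \in FV -> beta_idx' n (alpha_idx' m n r u) \in FV.
    by move=> /(alpha_idxP m2 n3)[_ /(beta_idxP m2 n3)[]].
  rewrite (pow_true k q t0_true)//; set v := iter _ _ _.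
  have vF : v \in FV by rewrite /v; elim: (k) => [//|i IHi]; exact: sgF.
  have ttF : (true, v) \in F by rewrite mem_F.
  case=> [[[p _ e]|[]]|[p _ e]].
  + by have [[<-]] := cell_inj cells (top_in true) ttF I I e.
  + exact: in_all_cells ttF _.
  + by case: (@pt_not_true 1%N (top, p) v q _ _ vF e) => //; lia.
- by rewrite t0_out.
Qed.

Lemma t0_period x : ~ cell setT theta (false, (0, 0)) x ->
  exists j, 0 < j <= N /\ (t0 ^+ j) x = x.
Proof.
have s3 := s_ge3; move=> nc; have [[w [z [ws zL xE]]]|[v [q [vF ->]]]|nx] := cell_cases x.
- have [w0|w0] := eqVneq w 0; last first.
    exists (s.-1 * L)%N; split; last by rewrite xE t0_row_period//; lia.
    by rewrite /N muln_gt0 -!addnA leq_addr; apply/andP; split=> //; lia.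
  exists r.+2; split; first by rewrite /N addnAC leq_addl.
  rewrite xE w0 t0_row0// s_map_period//; apply: contra_notN nc => /eqP z0.
  by exists z.2 => //; rewrite xE w0 /pt z0.
- have [j [/andP[j0 jF] jE]] := t0_true_period q vF.
  by exists j; split=> //; rewrite j0 (leq_trans jF)// leq_addl.
- by exists r.+2; split; [rewrite /N addnAC leq_addl|exact: t0_out].
Qed.

(** * The generators with the link *)

Variable rho : homeo CS.
Hypothesis rho_m : rho ^+ m = 1.
Hypothesis rho_supp : supp_in Y rho.
Let alpha : homeo CS := rho * alpha0.
Let t : homeo CS := alpha * beta.

Lemma alpha0_Y y : Y y -> alpha0 y = y.
Proof.
have s3 := s_ge3; have tL : top < L by [].
case=> [[[q _ <-]|nC]|[q _ <-]].
- rewrite alpha0_true; last by rewrite -(mem_F true) top_in.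
  rewrite /alpha_idx' /a_idx' /= /top /nb_cols /=.
  have -> : (m + r == 0) = false by lia.
  by have -> : (m + r < m) = false by lia.
- by case: alpha0P => _; apply.
- rewrite -/(pt 1%N (top, q)) alpha0_pt//; last by lia.
  by rewrite /= a_map_top.
Qed.

Lemma alpha_Y y : Y y -> alpha y = rho y.
Proof. by move=> Yy; rewrite homeo_mulE alpha0_Y//; exact: supp_in_stable. Qed.

Lemma alpha_off y : ~ Y y -> alpha y = alpha0 y.
Proof. by move=> nY; rewrite homeo_mulE rho_supp. Qed.

Lemma alpha_expm : alpha ^+ m = 1.
Proof.
rewrite expgMn ?rho_m ?alpha0_expm ?mul1g//.
apply: (@disjoint_commute Y (~` Y)) => //; first by move=> x Yx; exact.
by move=> x /contrapT; exact: alpha0_Y.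
Qed.

(** The cell in row n-1 and column 0 visits m distinct rows, none of them row 1, so the link does
    not interfere. *)
Lemma alpha_order : has_order alpha m.
Proof.
split=> [||k /andP[k0 km] ak]; [by lia|exact: alpha_expm|].
have s3 := s_ge3; have L0 : 0 < L by [].
have nF : n.-1 < s by rewrite /nb_rows; lia.
have zL : valid (0, (point : CS)) by [].
have akE i : i < m.-1 -> (alpha ^+ i) (pt n.-1 (0, point)) = pt (n.-1 + i) (0, point).
  move=> im; rewrite -alpha0_cycle//; elim: i im => [//|i IHi] im.
  rewrite expgSr homeo_mulE IHi; last exact: ltnW.
  rewrite alpha_off; first by rewrite [in RHS]expgSr homeo_mulE.
  rewrite alpha0_cycle//; last exact: ltnW.
  by move=> /pt_in_Y[||] //; rewrite /nb_rows; lia.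
have [km1|km1] := ltnP k m.-1.
  have := akE _ km1; rewrite ak => /pt_inj[] //; last by lia.
  by rewrite /nb_rows; lia.
have kE : k = m.-2.+1 by lia.
have sL : valid (s_map' (0, (point : CS))) by case: (s_mapP zL).
move: ak; rewrite kE => /(congr1 (fun f : homeo CS => f (pt n.-1 (0, point)))).
rewrite expgSr homeo_mulE akE; last by lia.
rewrite alpha_off; last by move=> /pt_in_Y[||] //; rewrite /nb_rows; lia.
rewrite -alpha0_cycle//; last by lia.
rewrite -homeo_mulE -expgSr (_ : m.-2.+1 = m.-1)%N; last by lia.
by rewrite alpha0_cycle0// => /pt_inj[] //; lia.
Qed.

Lemma beta_order : has_order beta n.
Proof.
split=> [||k /andP[k0 kn] bk]; [by lia|exact: beta_expn|].
have s3 := s_ge3; have ns : n <= s by rewrite /nb_rows; lia.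
have zL : valid (0, (point : CS)) by [].
have := beta_cycle zL kn; rewrite bk => /pt_inj[] //; lia.
Qed.

Lemma t_pow : exists M, [/\ 0 < M,
  supp_in (cell setT theta (false, (0, 0))) (t ^+ M) &
  forall q, (t ^+ M) (pt 0 (0, q)) = pt 0 (0, (h ^+ M) q)].
Proof.
have s3 := s_ge3.
(* A common multiple of all periods up to the bound [m * N] of [periodic_return]. *)
exists (m * N)`!; split=> [|x nx|q]; first exact: fact_gt0.
  have [||||j [/andP[j0 jN] tj]] := @periodic_return rho t0 Y m N x _ rho_m rho_supp.
  - by lia.
  - move=> y Yy; apply: t0_period => -[q _ e].
    have : pt 0 (0, q) = y by [].
    by move=> yE; move: Yy; rewrite -yE => /pt_in_Y[||] //; lia.
  - by move=> y i; exact: t0_Y.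
  - exact: t0_period.
  move: tj; rewrite mulgA -/alpha -/t => tj.
  have /dvdnP[k ->] : j %| (m * N)`! by apply: dvdn_fact; rewrite j0.
  rewrite mulnC expgnA; elim: k => [//|k IHk].
  by rewrite expgSr homeo_mulE IHk.
elim: _`! => [//|k IHk]; rewrite expgSr homeo_mulE IHk.
rewrite homeo_mulE alpha_off; last by move=> /pt_in_Y[||] //; lia.
rewrite -[LHS]homeo_mulE -/t0 t0_pt//; last by lia.
rewrite expgSr homeo_mulE /=; congr (pt 0 _).
rewrite /s_map /b_map' /a_map /= /a_idx.
by have -> : 0 < m.-1 by lia.
Qed.

(** Beta lifts row 0 to row 1, where alpha acts by [a_map] within the row except at the link, and
    the row is then brought back. *)
Let shift : homeo CS := beta * alpha * beta^-1.

Lemma shift_row0 z : valid z -> z.1 != top -> shift (pt 0 z) = pt 0 (a_map z).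
Proof.
move=> zL zt; have s3 := s_ge3; have [aL _ _ _] := a_mapP zL.
rewrite /shift 2!homeo_mulE beta_pt//; last by lia.
have -> : 0 < n.-1 by lia.
rewrite alpha_off; last by move=> /pt_in_Y[|//|_] /=; [lia|exact/eqP].
rewrite alpha0_pt//=; last by lia.
have <- : beta (pt 0 (a_map z)) = pt 1%N (a_map z).
  by rewrite beta_pt//; [have -> : 0 < n.-1 by lia|lia].
exact: homeo_mulKx.
Qed.

Lemma t_row0 z : valid z -> t (pt 0 z) = pt 0 (s_map z).
Proof.
move=> zL; have s3 := s_ge3.
rewrite homeo_mulE alpha_off; last by move=> /pt_in_Y[||] //; lia.
by rewrite -[LHS]homeo_mulE -/t0 t0_pt//; lia.
Qed.

Let step : homeo CS := t^-1 * shift.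

(** Undoing [s_map] and then applying [a_map] leaves the pure column shift. At column [top.-1] the
    inverse of t would land on the last column, where [shift] meets the link; hence the bound. *)
Lemma step_row0 j q : j < top.-1 -> step (pt 0 (j, q)) = pt 0 (j.+1, q).
Proof.
move=> jt; have jL : valid (j, q) by move: jt; rewrite /= /top; lia.
have [sL sL' _ sK] := s_mapP jL.
rewrite /step homeo_mulE -{1}sK -t_row0// homeo_mulKx shift_row0//.
  have [bL _ _ _] := b_mapP jL; have [_ _ _ aK] := a_mapP bL.
  rewrite /s_map' aK /b_map /= /b_idx.
  by have -> : j < L.-1 by rewrite -/top; lia.
rewrite /= /a_idx' /b_idx; have -> : j < L.-1 by rewrite -/top; lia.
by rewrite /top /nb_cols /= in jt *; repeat case: ifP; lia.
Qed.

Lemma step_pow j q : j < top -> (step ^+ j) (pt 0 (0, q)) = pt 0 (j, q).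
Proof.
elim: j => [//|j IHj] jt.
by rewrite expgSr homeo_mulE IHj ?step_row0//; lia.
Qed.

Lemma holonomy H a : is_subgroup H -> H alpha -> H beta -> a \in l ->
  exists2 k, H k & forall q, k (pt 0 (0, q)) = pt 0 (0, a q).
Proof.
move=> sH Ha Hb al; have kr : index a l < r by rewrite index_mem.
(* The column whose twist is a: going there by [step], applying [shift] once and coming back has
   holonomy a. *)
pose j := ((m + r).-1 - index a l)%N.
have jt : j < top by rewrite /j /top /nb_cols /=; lia.
have Hshift : H shift by do !apply: subgroupM => //; exact: subgroupV.
have Hstep : H step.
  by apply: subgroupM => //; apply: subgroupV => //; exact: subgroupM.
exists (step ^+ j * shift * (step ^+ j)^-1).
  apply: subgroupM => //; first by apply: subgroupM => //; exact: subgroupX.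
  by apply: subgroupV => //; exact: subgroupX.
move=> q; rewrite 2!homeo_mulE step_pow// shift_row0; last by rewrite neq_ltn jt.
  2: by rewrite (ltn_trans jt).
apply: (@homeo_inj (step ^+ j)); rewrite homeo_mulVKx step_pow//.
congr (pt 0 _); rewrite /a_map /a_idx /a_twist /=.
have -> : (j < m.-1) = false by rewrite /j; lia.
have -> : (j == m.-1) = false by rewrite /j; lia.
have -> : (j == 0) = false by rewrite /j; lia.
have -> : (m <= j) by rewrite /j; lia.
have -> : (j < m + r) by rewrite /j; lia.
have -> : ((m + r).-1 - j = index a l)%N by rewrite /j; lia.
by rewrite /= nth_index.
Qed.

(** [step] cannot reach the last column, so the route goes along the m-cycle by [shift], picking up
    h, then by t from column m-1 to the last one, which multiplies by h^-1, and finally by beta to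
    row 1. *)
Lemma path_to_top q :
  (shift ^+ m.-1 * t * beta) (pt 0 (0, q)) = pt 1%N (top, q).
Proof.
have s3 := s_ge3.
have e k : k < m.-1 -> (shift ^+ k.+1) (pt 0 (0, q)) = pt 0 (k.+1, h q).
  elim: k => [|k IHk] km.
    rewrite expg1 shift_row0//; last by rewrite /top /nb_cols /=; lia.
    by rewrite -(iter_a_map q km).
  rewrite expgSr homeo_mulE IHk; last exact: ltnW.
  rewrite shift_row0; last by rewrite /top /nb_cols /=; lia.
    by rewrite -(iter_a_map q km) iterS iter_a_map//; exact: ltnW.
  by rewrite /nb_cols /=; lia.
rewrite 2!homeo_mulE (_ : m.-1 = m.-2.+1); last by lia.
rewrite e; last by lia.
rewrite t_row0; last by rewrite /nb_cols /=; lia.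
have -> : s_map (m.-2.+1, h q) = (top, q).
  rewrite /s_map /b_map' /a_map /a_idx /a_twist /=.
  have -> : (m.-2.+1 < m.-1) = false by lia.
  have -> : (m.-2.+1 == m.-1) by lia.
  by rewrite homeo_mulKx.
rewrite beta_pt//; last by lia.
by have -> : 0 < n.-1 by lia.
Qed.

(** * Generation of [G] *)

Hypothesis Gsimple : simple_group G.
Hypothesis Gvig : vigorous G.
Hypothesis l_gen : forall K, is_subgroup K -> (forall a, a \in l -> K a) -> G `<=` K.
Hypothesis h_free : forall k, 0 < k -> h ^+ k <> 1.
Hypothesis outside : exists x, ~ all_cells F setT theta x.
Hypothesis rho_in : forall q, Y1 q -> exists2 x, Y0 x & rho x = q.
Hypothesis rho_stay : exists2 x, Y0 x & Y0 (rho x).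
Variable H : set (homeo CS).
Hypothesis Hsub : is_subgroup H.
Hypothesis HG : H `<=` G.
Hypothesis Ha : H alpha.
Hypothesis Hb : H beta.

Lemma filled_origin : filled G H (cell setT theta (false, (0, 0))).
Proof.
have [M [M0 tsupp tE]] := t_pow.
have c0 : (false, (0, 0)) \in F by rewrite mem_cell//; have := s_ge3; lia.
apply: (filled_cell Gsub Gsimple Gvig cells c0 Hsub l_gen _ _ tsupp tE _ (h_free M0)).
- by move=> a al; exact: holonomy.
- by apply: subgroupX => //; exact: subgroupM.
- by apply: subgroupX => //; exact: G_h.
Qed.

Lemma filled_top : filled G H Y0.
Proof.
pose k := shift ^+ m.-1 * t * beta.
have Hk : H k.
  do 2?apply: subgroupM => //; last exact: subgroupM.
  by apply: subgroupX => //; do !apply: subgroupM => //; exact: subgroupV.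
suff -> : Y0 = im k (cell setT theta (false, (0, 0))) by exact: filled_im filled_origin Hk.
rewrite imE eqEsubset; split=> [_ [q _ <-]|_ [_ [q _ <-] <-]].
  by exists (pt 0 (0, q)); [exists q|exact: path_to_top].
by exists q => //; exact/esym/path_to_top.
Qed.

Lemma alphaV_off y : ~ Y y -> alpha^-1 y = alpha0^-1 y.
Proof.
move=> nY; apply: (@homeo_inj alpha); rewrite homeo_mulVKx alpha_off ?homeo_mulVKx//.
by move=> Yx; have := alpha0_Y Yx; rewrite homeo_mulVKx => yE; apply: nY; rewrite yE.
Qed.

Lemma true_in_Y v q : v \in FV -> Y (theta (true, v) q) -> v = (1%N, top).
Proof.
have s3 := s_ge3; have tL : top < L by [].
move=> vF [[[p _ e]|[]]|[p _ e]].
- have [] := cell_inj cells (top_in true) _ I I e; first by rewrite mem_F.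
  by case=> <-.
- by apply: in_all_cells; rewrite ?mem_F.
- by case: (@pt_not_true 1%N (top, p) v q _ _ vF e) => //; lia.
Qed.

Lemma generate : G `<=` H.
Proof.
have s3 := s_ge3; have tL : top < L by [].
have cY0 : clopen Y0 by apply: cell_clopen cells _ _; exact: top_in.
have top1 : (alpha_idx m n r (1%N, top) = (1%N, top)).
  have := a_map_top point; rewrite /a_map /= => -[e _].
  by rewrite /alpha_idx /= e.
apply: (filled_exhaust Gsub Gsimple Gvig Hsub HG filled_top cY0 Ha Hb).
- have [x Yx Yrx] := rho_stay; exists x; split=> //.
  by rewrite alpha_Y//; right.
(* A point of the rest of the space is fixed by beta, and the link makes it an image of the link
   cell under alpha. *)
- have [q nq] := outside; have [x Yx xq] := rho_in (or_intror nq).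
  exists x; split=> //; rewrite alpha_Y ?xq; last by right.
  by case: betaP => _; apply.
move=> K YK Kstep.
have Ka x : K x -> K (alpha x) by apply: Kstep; rewrite !inE eqxx.
have KaV x : K x -> K (alpha^-1 x) by apply: Kstep; rewrite !inE eqxx orbT.
have Kb x : K x -> K (beta x) by apply: Kstep; rewrite !inE eqxx !orbT.
have KbV x : K x -> K (beta^-1 x) by apply: Kstep; rewrite !inE eqxx !orbT.
have KY1 q : Y1 q -> K q.
  move=> Yq; have [x Yx <-] := rho_in Yq.
  by rewrite -alpha_Y; [exact/Ka/YK|right].
rewrite eqEsubset; split=> // x _.
have [[w [[i q] [ws zL ->]]]|[v [q [vF ->]]]|nx] := cell_cases x; last 1 first.
- by apply: KY1; right.
- have {ws zL} vF : (w, i) \in FV by rewrite mem_indices ws zL.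
  have bE v p : v \in FV -> beta (theta (false, v) p) = theta (false, beta_idx n v) p.
    by move=> vI; rewrite betaP.1 ?mem_F.
  pose P v := forall q, K (theta (false, v) q).
  apply: (@indices_connected m n r m2 n3 P) vF q; last by move=> p; apply: YK; exists p.
  case=> {}w {}i {}vF Kv; move: (vF); rewrite mem_indices => /andP[ws iL].
  have [a1 a2 a3 a4] := beta_idxP m2 n3 vF.
  split=> q; last 1 first.
  + have -> : theta (false, beta_idx' n (w, i)) q = beta^-1 (theta (false, (w, i)) q).
      by apply: (@homeo_inj beta); rewrite homeo_mulVKx bE// a4.
    exact: KbV.
  (* On the link cell alpha acts by [rho], but there [alpha_idx] fixes the index and the claim is
     already known. *)
  + have [vtop|vtop] := pselect ((w, i) = (1%N, top)); first by rewrite vtop top1 -vtop.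
    have := alpha0P.1 (false, (w, i)) ((alpha_twist (false, (w, i)))^-1 q).
    rewrite mem_F vF => /(_ isT I); rewrite homeo_mulVKx /= => <-.
    rewrite -alpha_off; first exact: Ka.
    by move=> /(@pt_in_Y w (i, _) ws iL)[e1 e2]; apply: vtop; rewrite e1 -e2.
  + by rewrite -bE//; exact: Kb.
(* In the second copy the generators act by the inverse index maps, so [alpha_idx] and [beta_idx]
   are realised by their inverses; the link provides the starting cell. *)
- pose P v := forall q, K (theta (true, v) q).
  apply: (@indices_connected m n r m2 n3 P) vF q; last first.
    by move=> p; apply: KY1; left; exists p.
  move=> {}v {}vF Kv; have [a1 a2 a3 a4] := beta_idxP m2 n3 vF.
  have [b1 b2 b3 b4] := alpha_idxP m2 n3 vF.
  split=> q.
  + have [vtop|vtop] := pselect (v = (1%N, top)); first by rewrite vtop top1 -vtop.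
    have -> : theta (true, alpha_idx m n r v) q = alpha^-1 (theta (true, v) q).
      rewrite alphaV_off; last by move/(true_in_Y vF).
      by apply: (@homeo_inj alpha0); rewrite homeo_mulVKx alpha0_true// b3.
    exact: KaV.
  + have -> : theta (true, beta_idx n v) q = beta^-1 (theta (true, v) q).
      by apply: (@homeo_inj beta); rewrite homeo_mulVKx beta_true// a3.
    exact: KbV.
  + by rewrite -beta_true//; exact: Kb.
Qed.

End Design.

Local Close Scope group_scope.

Theorem theorem1 (G : set (homeo cantor_space)) (m n : nat)
    (Gsub : is_subgroup G) (Gfg : finitely_generated G)
    (Gsimple : simple_group G) (Gvig : vigorous G)
    (m_ge2 : 2 <= m) (n_ge3 : 3 <= n) :
  exists a b : homeo cantor_space,
    [/\ G a, G b, has_order a m, has_order b n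
      & G = subgroup_generated [set a; b]].
Proof.
have [l [l_torsion l_gen h_free]] := torsion_generators Gsub Gsimple Gvig m_ge2 Gfg.
have [theta [cells [x0 out]]] := full_cells Gsub Gvig (bool * (nat * nat))%type.
pose r := size l; pose s := nb_rows m n; pose FV := indices m n r.
pose F := [seq (e, v) | e <- [:: false; true], v <- FV].
have outside : exists x, ~ all_cells F setT theta x.
  by exists x0 => -[j _ [q _ /out]].
have Gtwist j : j \in F -> G (alpha_twist m n l j).
  move=> _; case: j => e [w i]; have Ga k : G (a_twist m l k).
    exact: a_twist_in_G.
  rewrite /alpha_twist; case: e; first exact: subgroup1.
  case: ifP => _ //; case: ifP => _; last exact: subgroup1.
  exact: subgroupV.
have inF e v : ((e, v) \in F) = (v \in FV) by exact: mem_F.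
have pa : cell_perm F
    (fun j => (j.1, if j.1 then alpha_idx' m n r j.2 else alpha_idx m n r j.2))
    (fun j => (j.1, if j.1 then alpha_idx m n r j.2 else alpha_idx' m n r j.2)).
  by case=> [[] v]; rewrite inF /= !inF => /(alpha_idxP m_ge2 n_ge3)[? ? -> ->].
have pb : cell_perm F
    (fun j => (j.1, if j.1 then beta_idx' n j.2 else beta_idx n j.2))
    (fun j => (j.1, if j.1 then beta_idx n j.2 else beta_idx' n j.2)).
  by case=> [[] v]; rewrite inF /= !inF => /(beta_idxP m_ge2 n_ge3)[? ? -> ->].
have [|alpha0 [_ alpha0P]] := monomial_exists Gsub (cells F) pa (g := alpha_twist m n l).
  by move=> j /Gtwist.
have tw1 : cell_twist G F setT (fun=> 1%g) by exact: cell_twist1.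
have [beta [_ betaP]] := monomial_exists Gsub (cells F) pb tw1.
have Galpha0 : G alpha0.
  apply: (monomial_in_G Gsub Gsimple Gvig (cells F) outside _ Gtwist alpha0P) => v.
  by case/(alpha_idxP m_ge2 n_ge3).
have Gbeta : G beta.
  apply: (monomial_in_G Gsub Gsimple Gvig (cells F) outside _ _ betaP) => v.
    by case/(beta_idxP m_ge2 n_ge3).
  by move=> _; exact: subgroup1.
pose top := (1%N, (nb_cols m r).-1).
have topF e : (e, top) \in F by exact: top_in.
pose E := cell setT theta (true, top) `|` ~` all_cells F setT theta.
pose D := cell setT theta (false, top).
have cD : clopen D by exact: (cell_clopen (cells F)).
have cE : clopen E.
  apply: clopenU; first exact: (cell_clopen (cells F)).
  by apply: clopen_setC; exact: (all_cells_clopen (cells F)).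
have DE x : D x -> ~ E x.
  move=> [q _ <-] [[q' _ /(cell_inj (cells F) (topF true) (topF false) I I)[]//]|].
  by apply; exact: in_all_cells.
have [||rho [Grho rho_m rho_supp rho_in rho_stay]] :=
  rotation_exists Gsub Gsimple Gvig m_ge2 cE cD _ _ DE.
- by have [x nx] := outside; exists x; right.
- by exists (theta (false, top) point), point.
exists (rho * alpha0)%g, beta.
have Galpha : G (rho * alpha0)%g by exact: subgroupM.
split=> //.
- exact: (alpha_order m_ge2 n_ge3 l_torsion (cells F) alpha0P rho_m rho_supp).
- exact: (beta_order m_ge2 n_ge3 (cells F) betaP).
- pose H := subgroup_generated [set (rho * alpha0)%g; beta].
  have HG : H `<=` G by apply: generated_sub => // _ [|] ->.
  rewrite eqEsubset; split=> //.
  apply: (generate Gsub m_ge2 n_ge3 l_torsion (cells F) alpha0P betaP rho_m) => //.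
  + exact: generated_is_subgroup.
  + by apply: sub_generated; left.
  + by apply: sub_generated; right.
Qed.
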